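(* For every $\varepsilon>0$ and every integer $r\ge2$ there exists a constant $K'=K'(r,\varepsilon)$ such that the following holds for every positive integer $n$ with $p:=K'n^{-1/r}\le 1$. If the edges of the random graph $G(n,p)$ are colored independently and uniformly at random with $q\ge rn$ colors, then with probability at least $1-\varepsilon$ the resulting graph contains a rainbow $r$-th power of a Hamilton cycle.
   Context: $G(n,p)$ is the binomial random graph on $n$ vertices. The $r$-th power of a graph $G$ is obtained from $G$ by adding edges between all pairs of vertices at distance at most $r$ in $G$. The $r$-th power of a Hamilton cycle in an $n$-vertex graph is a subgraph that is the $r$-th power of a cycle through all $n$ vertices. A subgraph is rainbow if its edges have pairwise distinct colors. *)

(* Defs.v *)
From mathcomp Require Export all_boot all_order all_algebra.
From mathcomp Require Export reals exp.
Set Implicit Arguments.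
Unset Strict Implicit.
Unset Printing Implicit Defensive.
Import Order.TTheory GRing.Theory Num.Theory.
Local Open Scope ring_scope.

Definition edge (T : finType) := {e : {set T} | #|e| == 2%N}.

(* Finite simple graphs with vertex set T, given by their edge sets. *)
Notation graph T := {set edge T}.

Section Powers.
Variable T : finType.
Implicit Types (G H C : graph T) (c : seq T) (x y : T) (r : nat).

Definition adj G : rel T := [rel x y | [exists e in G, val e == [set x; y]]].

(* The distance of x and y in G is at most r: some path of length at most r,
   i.e. with at most r vertices after x, joins them. *)
Definition dist_le G r x y : bool :=
  [exists s : r.-bseq T,
    [&& path (adj G) x s, uniq (x :: s) & last x s == y]].

(* Elements of [edge T] join distinct vertices, so no loops are added. *)
Definition graph_power r G : graph T :=
  G :|: [set e | [exists x, exists y,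
                    (val e == [set x; y]) && dist_le G r x y]].

(* C is the edge set of a cycle through all vertices, listed in cyclic order
   by c; a cycle has at least three vertices. *)
Definition hamilton_cycle C : bool :=
  [exists c : #|T|.-tuple T,
    [&& (2 < #|T|)%N, uniq c &
        C == [set e | [exists x, val e == [set x; next c x]]]]].

Definition power_of_hamilton_cycle r H : bool :=
  [exists C, hamilton_cycle C && (H == graph_power r C)].

End Powers.

Definition coloring (T : finType) (q : nat) (G : graph T) :=
  {ffun {e : edge T | e \in G} -> 'I_q}.

Definition rainbow (T : finType) (q : nat) (G : graph T) (col : coloring q G)
    (H : graph T) : bool :=
  dinjectiveb col [pred e | val e \in H].

Definition has_rainbow_hamilton_power (T : finType) (r q : nat) (G : graph T)
    (col : coloring q G) : bool :=
  [exists H : graph T,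
    [&& H \subset G, power_of_hamilton_cycle r H & rainbow col H]].

Section RandomColoredGraph.
Variables (R : realType) (n : nat) (p : R) (q : nat).

Definition gnp_mass (G : graph 'I_n) : R :=
  \prod_(e : edge 'I_n) (if e \in G then p else 1 - p).

Definition coloring_mass (G : graph 'I_n) (col : coloring q G) : R :=
  \prod_(e : {e : edge 'I_n | e \in G}) q%:R^-1.

(* Probability of the event A when G is drawn from G(n,p) and then, given G,
   its edges are coloured independently and uniformly with q colours. *)
Definition colored_gnp_prob (A : forall G : graph 'I_n, coloring q G -> bool)
    : R :=
  \sum_(G : graph 'I_n)
    \sum_(col : coloring q G | A G col) gnp_mass G * coloring_mass col.

Lemma colored_gnp_probT : (0 < q)%N -> colored_gnp_prob (fun _ _ => true) = 1.
Proof.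
move=> q0; rewrite /colored_gnp_prob.
transitivity (\sum_(G : graph 'I_n) gnp_mass G).
  apply: eq_bigr => G _; rewrite -mulr_sumr -[RHS]mulr1; congr (_ * _).
  rewrite /coloring_mass
    -(bigA_distr_bigA (fun (_ : {e | e \in G}) (_ : 'I_q) => q%:R^-1 : R)).
  apply: big1 => e _; rewrite sumr_const card_ord -[_ *+ q]mulr_natr mulVf//.
  by rewrite pnatr_eq0 -lt0n.
have := @bigA_distr R 0 1 *%R +%R _ (fun _ : edge 'I_n => p) (fun=> 1 - p).
rewrite big1; last by move=> e _; rewrite /= addrC subrK.
by move=> ->; apply: eq_bigl => G; rewrite inE.
Qed.

End RandomColoredGraph.

(* Main.v *)
Require Import Defs.
From mathcomp Require Import all_boot all_order all_algebra.
From mathcomp Require Import reals exp.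
From mathcomp Require Import all_fingroup sequences ring lra zify.
Set Implicit Arguments.
Unset Strict Implicit.
Unset Printing Implicit Defensive.
Import Order.TTheory GRing.Theory Num.Theory.
Local Open Scope ring_scope.

(* Idea (fragmentation and second moment, after Kahn, Narayanan and Park). Take
   w = (s, t) uniform in S_n x S_q; it places the r-th power of the cyclic order
   by s and colours its edges through t, giving a set S w of coloured edges.
   The colouring V is a product measure over edges, with values in
   "absent or one of q colours", and each edge is present with probability p.

   Round one, with density p/2: for a colouring W, let the fragment of w be the
   smallest S w' \ W with S w' contained in S w and W together. A fragment T is
   contained in the member selected, in any fixed way, from W overwritten by T,
   so a union bound over T only involves the sums
   sum_A (2q/p)^|A| P(A is contained in S w) over the large subsets A of one
   member. These show that the fragment usually has at most n^(1/r) edges.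
   Round two: given W, a second moment estimate, governed by the same sums over
   the nonempty subsets of one small fragment, shows that an independent copy of
   density p/2 usually contains some fragment.

   To bound the sums, P(A is contained in S w) is at most
   (C/q)^|A| n^(-rho), where rho is the size of a forest in A. Reading the cyclic
   order from left to right, a vertex sending at least one edge back contributes
   one edge to the forest, and all of its edges if the r previous vertices send
   none. Each chain of such vertices thus gains n^(-(r-1)/r) over n^(-|A|/r). *)

(** * Expectation under a product measure *)

Section ProductMeasure.
Variables (R : realType) (E T : finType).
Implicit Types (W : {ffun E -> T}) (m : T -> R) (phi : {ffun E -> T} -> R).

Definition upd W (e : E) (t : T) : {ffun E -> T} :=
  [ffun i => if i == e then t else W i].

Lemma upd_same W e t : upd W e t e = t.
Proof. by rewrite ffunE eqxx. Qed.

Lemma upd_other W e t i : i != e -> upd W e t i = W i.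
Proof. by rewrite ffunE => /negbTE->. Qed.

Definition expect m phi : R := \sum_(W : {ffun E -> T}) (\prod_e m (W e)) * phi W.

(** Exchanging [W e] with an independent sample [t] is an involution on the pairs [(W, t)] that
    preserves their joint mass. *)
Lemma expect_resample m e phi : \sum_t m t = 1 ->
  expect m phi = expect m (fun W => \sum_t m t * phi (upd W e t)).
Proof.
move=> m1; rewrite /expect.
under [RHS]eq_bigr => W _ do rewrite mulr_sumr.
rewrite pair_big /=.
pose sw (u : {ffun E -> T} * T) := (upd u.1 e u.2, u.1 e).
have swK : involutive sw.
  case=> W t; rewrite /sw /= upd_same; congr pair.
  by apply/ffunP=> i; rewrite !ffunE; case: eqP => [->|].
rewrite (reindex_inj (inv_inj swK)) /=.
rewrite (eq_bigr (fun u : {ffun E -> T} * T =>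
   (\prod_i m (u.1 i)) * phi u.1 * m u.2)); last first.
  case=> W t _ /=.
  rewrite (bigD1 e) //= upd_same [in RHS](bigD1 e) //=.
  rewrite (eq_bigr (fun i => m (W i))) => [|i ie]; last by rewrite upd_other.
  have -> : upd (upd W e t) e (W e) = W.
    by apply/ffunP=> i; rewrite !ffunE; case: eqP => [->|].
  ring.
rewrite -(pair_big xpredT xpredT
  (fun W t => (\prod_i m (W i)) * phi W * m t)) /=.
by apply: eq_bigr => W _; rewrite -mulr_sumr m1 mulr1.
Qed.

Lemma eq_expect m phi psi : phi =1 psi -> expect m phi = expect m psi.
Proof. by move=> h; apply: eq_bigr => W _; rewrite h. Qed.

Lemma le_expect m phi psi : (forall t, 0 <= m t) ->
  (forall W, phi W <= psi W) -> expect m phi <= expect m psi.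
Proof.
by move=> m0 h; apply: ler_sum => W _; rewrite ler_wpM2l ?h // prodr_ge0.
Qed.

Lemma expectZ m (c : R) phi : expect m (fun W => c * phi W) = c * expect m phi.
Proof. by rewrite /expect mulr_sumr; apply: eq_bigr => W _; rewrite mulrCA. Qed.

Lemma expectD m phi psi :
  expect m (fun W => phi W + psi W) = expect m phi + expect m psi.
Proof. by rewrite /expect -big_split; apply: eq_bigr => W _; rewrite mulrDr. Qed.

Lemma expect_sum (I : finType) (P : pred I) m (F : I -> {ffun E -> T} -> R) :
  expect m (fun W => \sum_(i | P i) F i W) = \sum_(i | P i) expect m (F i).
Proof.
rewrite /expect exchange_big; apply: eq_bigr => W _.
by rewrite mulr_sumr.
Qed.

Lemma expect1 m : \sum_t m t = 1 -> expect m (fun=> 1) = 1.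
Proof.
move=> m1; rewrite /expect; under eq_bigr do rewrite mulr1.
by rewrite -(bigA_distr_bigA (fun (_ : E) t => m t)) big1.
Qed.

Lemma expect_cst m (c : R) : \sum_t m t = 1 -> expect m (fun=> c) = c.
Proof.
move=> m1; rewrite -[RHS]mulr1 -(expect1 m1) -expectZ.
by apply: eq_expect => W; rewrite mulr1.
Qed.

End ProductMeasure.

(** * Random partial colourings: density [p], uniform colours *)

Section PartialColourings.
Variables (R : realType) (E C : finType).
Implicit Types (W Z : {ffun E -> option C}) (A B : {set E * C}) (p : R).

Definition cmass p (o : option C) : R :=
  if o is Some _ then p / #|C|%:R else 1 - p.

Lemma cmass_ge0 p o : 0 <= p -> p <= 1 -> 0 <= cmass p o.
Proof.
by case: o => [c|] p0 p1 /=; rewrite ?subr_ge0 // divr_ge0.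
Qed.

Lemma sum_option (F : option C -> R) :
  \sum_o F o = F None + \sum_c F (Some c).
Proof.
rewrite (bigD1 None) //=; congr (_ + _).
rewrite (reindex_omap Some id) //=; last by case.
by apply: eq_bigl => c; rewrite eqxx.
Qed.

Lemma cmass1 p : (0 < #|C|)%N -> \sum_o cmass p o = 1.
Proof.
move=> C0; rewrite sum_option /= sumr_const -[_ *+ _]mulr_natr -mulrA mulVf.
  by rewrite mulr1 subrK.
by rewrite pnatr_eq0 -lt0n.
Qed.

Definition gr W : {set E * C} := [set x | W x.1 == Some x.2].

Definition overwrite (s : seq (E * C)) W : {ffun E -> option C} :=
  foldr (fun a Z => upd Z a.1 (Some a.2)) W s.

Lemma mem_gr_overwrite s W e c : uniq (unzip1 s) ->
  ((e, c) \in gr (overwrite s W)) =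
  ((e, c) \in s) || ((e \notin unzip1 s) && ((e, c) \in gr W)).
Proof.
elim: s => [|[e1 c1] s IH] /=; first by [].
case/andP=> e1s us; rewrite !inE /= ffunE xpair_eqE.
case: (eqVneq e e1) => [->|ne] /=.
  rewrite orbF (inj_eq Some_inj) [c == c1]eq_sym.
  suff -> : (e1, c) \in s = false by rewrite orbF.
  by apply: contraNF e1s => h; apply/mapP; exists (e1, c).
by have := IH us; rewrite !inE /=.
Qed.

(** Overwriting with [s] gives the law of the colouring conditioned on containing [s]. Each pair of
    [s] has mass [p / #|C|], so the change of measure costs one factor [#|C| / p] per pair. *)
Lemma expect_overwrite p s (g : {ffun E -> option C} -> R) :
  (0 < #|C|)%N -> 0 < p -> uniq (unzip1 s) ->
  expect (cmass p) (fun W => g (overwrite s W)) =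
  (#|C|%:R / p) ^+ size s *
    expect (cmass p) (fun Z => (all (mem (gr Z)) s)%:R * g Z).
Proof.
move=> C0 p0; have Cn : #|C|%:R != 0 :> R by rewrite pnatr_eq0 -lt0n.
elim: s g => [|[e c] s IH] g /=.
  by rewrite expr0 mul1r => _; apply: eq_expect => W; rewrite mul1r.
case/andP=> es us.
rewrite (IH (fun Z => g (upd Z e (Some c)))) // exprSr -mulrA; congr (_ * _).
rewrite [expect _ (fun Z => (_ && _)%:R * _)](expect_resample e) ?cmass1 //.
rewrite (_ : _ / p * _ = #|C|%:R / p * (p / #|C|%:R *
   expect (cmass p) (fun Z => (all (mem (gr Z)) s)%:R * g (upd Z e (Some c))))).
  by rewrite mulrA [_ / p * _]mulrA divfK ?gt_eqF // divff // mul1r.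
congr (_ * _); rewrite -expectZ; apply: eq_expect => Z.
rewrite (bigD1 (Some c)) //= big1 => [|o /negbTE oc].
  rewrite addr0 !inE /= upd_same eqxx /=; congr (_ * (_%:R * _)).
  congr nat_of_bool; apply: eq_in_all => -[e1 c1] /= h.
  rewrite !inE /= upd_other //; apply: contraNneq es => <-.
  by apply/mapP; exists (e1, c1).
by rewrite !inE /= upd_same oc /= mul0r mulr0.
Qed.

Definition functional A := {in A &, injective (@fst E C)}.

Lemma functional_uniq A : functional A -> uniq (unzip1 (enum A)).
Proof.
by move=> fA; rewrite map_inj_in_uniq ?enum_uniq // => x y; rewrite !mem_enum; exact: fA.
Qed.

Lemma all_enum_subset A Z : all (mem (gr Z)) (enum A) = (A \subset gr Z).
Proof.
apply/allP/subsetP => h x; first by move=> xA; apply: h; rewrite mem_enum.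
by rewrite mem_enum => /h.
Qed.

Lemma expect_overwrite_set p A (g : {ffun E -> option C} -> R) :
  (0 < #|C|)%N -> 0 < p -> functional A ->
  expect (cmass p) (fun W => g (overwrite (enum A) W)) =
  (#|C|%:R / p) ^+ #|A| *
    expect (cmass p) (fun Z => (A \subset gr Z)%:R * g Z).
Proof.
move=> C0 p0 fA; rewrite expect_overwrite // ?functional_uniq // -cardE.
by congr (_ * _); apply: eq_expect => Z; rewrite all_enum_subset.
Qed.

Lemma prob_subset p A : (0 < #|C|)%N -> 0 < p -> functional A ->
  expect (cmass p) (fun Z => (A \subset gr Z)%:R) = (#|C|%:R / p) ^- #|A|.
Proof.
move=> C0 p0 fA; have := @expect_overwrite_set p A (fun=> 1) C0 p0 fA.
rewrite expect1 ?cmass1 // => h.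
have x0 : (#|C|%:R / p) ^+ #|A| != 0.
  by rewrite expf_neq0 // mulf_neq0 ?invr_neq0 ?gt_eqF // ltr0n.
apply: (mulfI x0); rewrite divff // [RHS]h; congr (_ * _).
by apply: eq_expect => Z; rewrite mulr1.
Qed.

Lemma functional_gr Z : functional (gr Z).
Proof.
move=> [e c] [e' c']; rewrite !inE /= => /eqP h /eqP h' ee.
by move: h h'; rewrite ee => -> [->].
Qed.

(** A set giving two colours to one edge lies in no [gr Z], so [prob_subset] extends to every [A] as
    an inequality. *)
Lemma prob_subset_le p A : (0 < #|C|)%N -> 0 < p ->
  expect (cmass p) (fun Z => (A \subset gr Z)%:R) <= (#|C|%:R / p) ^- #|A|.
Proof.
move=> C0 p0; case: (boolP [exists Z : {ffun E -> option C}, A \subset gr Z]).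
  case/existsP=> Z AZ; rewrite prob_subset // => x y xA yA.
  by apply: (@functional_gr Z); exact: (subsetP AZ).
move=> no; rewrite (@eq_expect _ _ _ _ _ (fun=> 0)) => [|Z]; last first.
  by case: (boolP (A \subset gr Z)) => // h; case/existsP: no; exists Z.
rewrite /expect big1 => [|W _]; last by rewrite mulr0.
by rewrite invr_ge0 exprn_ge0 // divr_ge0 // ltW.
Qed.

(** Both inclusions amount to containing [A :|: B], where common pairs are paid for once only; hence
    the positive power of the overlap. *)
Lemma prob_subset2 p A B : (0 < #|C|)%N -> 0 < p ->
  expect (cmass p) (fun Z => (A \subset gr Z)%:R * (B \subset gr Z)%:R) <=
  (#|C|%:R / p) ^- #|A| * (#|C|%:R / p) ^- #|B| *
    (#|C|%:R / p) ^+ #|A :&: B|.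
Proof.
move=> C0 p0; have x0 : #|C|%:R / p != 0.
  by rewrite mulf_neq0 ?invr_neq0 ?gt_eqF // ltr0n.
have h := prob_subset_le (A :|: B) C0 p0.
rewrite (@eq_expect _ _ _ _ _ (fun Z => (A :|: B \subset gr Z)%:R)); last first.
  by move=> Z; rewrite subUset -natrM mulnb.
apply: (le_trans h); rewrite le_eqVlt; apply/orP; left; apply/eqP.
apply: (mulfI (expf_neq0 #|A :|: B| x0)); rewrite divff ?expf_neq0 //.
by rewrite mulrCA -exprD cardsUI exprD mulrACA !mulVf ?mul1r ?expf_neq0.
Qed.

End PartialColourings.

(** * Coupling two sparse rounds with one denser round *)

Section Families.
Variables (R : realType) (E C Om : finType) (S : Om -> {set E * C}).
Hypothesis funS : forall w, functional (S w).
Hypothesis C0 : (0 < #|C|)%N.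
Implicit Types (W V Z : {ffun E -> option C}) (D : {set E}) (A : {set E * C}).
Implicit Types (w : Om) (p : R).

Section Hybrid.

(** The hybrid experiments of the coupling: edges of [D] have already switched to the single
    colouring [V], the others still use [W] and [W'] together. *)
Definition hits D W W' V (x : E * C) : bool :=
  if x.1 \in D then x \in gr V else (x \in gr W) || (x \in gr W').

Definition hybrid D W W' V : bool :=
  [exists w, [forall x in S w, hits D W W' V x]].

(** Freeze all edges but [e]. If some member is complete without using [e] ([base]), the right side
    is 1. Otherwise [e] must show a colour satisfying [ind]: by a union bound two draws of density
    [p] do so with probability at most [2 * p / #|C|] per such colour, and one draw of density
    [2 * p] attains this. *)
Lemma hybrid_resample p D (e : E) W W' V : 0 <= p -> 2 * p <= 1 -> e \notin D ->
  \sum_o cmass p o * \sum_o' cmass p o' * (hybrid D (upd W e o) (upd W' e o') V)%:R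
  <= \sum_o cmass (2 * p) o * (hybrid (e |: D) W W' (upd V e o))%:R.
Proof.
move=> p0 p21 eD; have p1 : p <= 1 by lra.
have m0 o : 0 <= cmass p o :> R by rewrite cmass_ge0.
have m20 o : 0 <= cmass (2 * p) o :> R by rewrite cmass_ge0 //; lra.
pose rest w := [forall x in S w, (x.1 != e) ==> hits D W W' V x].
pose base := [exists w, rest w && [forall x in S w, x.1 != e]].
pose ind (o : option C) :=
  if o is Some c then [exists w, rest w && ((e, c) \in S w)] else false.
have restW w o o' : [forall x in S w, hits D (upd W e o) (upd W' e o') V x] ->
    rest w.
  move=> /forall_inP h; apply/forall_inP=> x xS; apply/implyP=> xe.
  by have := h x xS; rewrite /hits !inE !upd_other.
have ltr o o' : hybrid D (upd W e o) (upd W' e o') V ->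
    base || (ind o || ind o').
  case/existsP=> w hw; have rw := restW _ _ _ hw.
  case: (boolP [forall x in S w, x.1 != e]) => [h|].
    by apply/orP; left; apply/existsP; exists w; rewrite rw.
  rewrite negb_forall => /existsP[[e1 c]]; rewrite negb_imply negbK /=.
  case/andP=> xS /eqP ee; rewrite ee in xS.
  have := forall_inP hw _ xS; rewrite /hits /= (negbTE eD) !inE /= !upd_same.
  have ex : [exists w, rest w && ((e, c) \in S w)].
    by apply/existsP; exists w; rewrite rw.
  by case/orP=> /eqP -> /=; rewrite ex ?orbT.
have rest_hits w o x : rest w -> x \in S w -> x.1 != e ->
    hits (e |: D) W W' (upd V e o) x.
  move=> rw xS xe; have := forall_inP rw x xS; rewrite xe /= /hits.
  by rewrite !inE (negbTE xe) /= upd_other.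
have rtl_base o : base -> hybrid (e |: D) W W' (upd V e o).
  case/existsP=> w /andP[rw /forall_inP h]; apply/existsP; exists w.
  by apply/forall_inP=> x xS; apply: (rest_hits w) => //; exact: h.
have rtl_ind o : ind o -> hybrid (e |: D) W W' (upd V e o).
  case: o => // c /existsP[w /andP[rw eS]]; apply/existsP; exists w.
  apply/forall_inP=> x xS; have [xe|] := eqVneq x.1 e; last first.
    exact: (rest_hits w).
  have -> : x = (e, c) by apply: (funS xS eS).
  by rewrite /hits /= !inE eqxx /= upd_same eqxx.
case: (boolP base) => [hb|nb].
  rewrite [leRHS](eq_bigr (fun o => cmass (2 * p) o)) ?cmass1 //; last first.
    by move=> o _; rewrite rtl_base // mulr1.
  apply: (@le_trans _ _ (\sum_(o : option C) cmass p o)); last by rewrite cmass1.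
  apply: ler_sum => o _; rewrite -[leRHS]mulr1 ler_wpM2l //.
  rewrite -[leRHS](cmass1 p C0); apply: ler_sum => o' _.
  by rewrite -[leRHS]mulr1 ler_wpM2l // lern1 leq_b1.
have lhs : \sum_o cmass p o * \sum_o' cmass p o' *
    (hybrid D (upd W e o) (upd W' e o') V)%:R <=
    \sum_o cmass p o * \sum_o' cmass p o' * ((ind o)%:R + (ind o')%:R).
  apply: ler_sum => o _; rewrite ler_wpM2l //; apply: ler_sum => o' _.
  rewrite ler_wpM2l // -natrD ler_nat.
  case h: (hybrid _ _ _ _) => //=; have := ltr _ _ h.
  by rewrite (negbTE nb) /=; case: (ind o); case: (ind o').
apply: (le_trans lhs).
rewrite (_ : \sum_o _ = 2 * \sum_o cmass p o * (ind o)%:R).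
  rewrite mulr_sumr !sum_option /= !mulr0 !add0r ler_wpDl ?mulr_ge0 ?(m20 C None) //.
  apply: ler_sum => c _; rewrite !mulrA ler_wpM2l //.
    by rewrite divr_ge0 // mulr_ge0.
  rewrite ler_nat; case h: [exists w, _] => //.
  by rewrite (rtl_ind (Some c)).
under eq_bigr => o _.
  rewrite (eq_bigr (fun o' => cmass p o' * (ind o)%:R + cmass p o' * (ind o')%:R));
    last by move=> o' _; rewrite mulrDr.
  rewrite big_split /= -mulr_suml cmass1 // mul1r mulrDr.
  over.
by rewrite big_split /= -mulr_suml cmass1 // mul1r mulr2n mulrDl mul1r.
Qed.

(* McDiarmid's coupling: replacing the two independent colourings by a single
   one of twice the density, one edge at a time, only increases the chance of
   containing a member of the family, as a member uses one colour per edge. *)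
Lemma two_rounds_le p : 0 <= p -> 2 * p <= 1 ->
  expect (cmass p) (fun W => expect (cmass p) (fun W' =>
    [exists w, S w \subset gr W :|: gr W']%:R)) <=
  expect (cmass (2 * p)) (fun V => [exists w, S w \subset gr V]%:R).
Proof.
move=> p0 p21; have p1 : p <= 1 by lra.
have m0 o : 0 <= cmass p o :> R by rewrite cmass_ge0.
have m20 o : 0 <= cmass (2 * p) o :> R by rewrite cmass_ge0 //; lra.
pose P D := expect (cmass p) (fun W => expect (cmass p) (fun W' =>
  expect (cmass (2 * p)) (fun V => (hybrid D W W' V)%:R))) : R.
have step D e : e \notin D -> P D <= P (e |: D).
  move=> eD; rewrite /P.
  rewrite (expect_resample e) ?cmass1 //.
  rewrite (@eq_expect _ _ _ _ _ (fun W => expect (cmass p) (fun W' =>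
    expect (cmass (2 * p)) (fun V => \sum_o cmass p o *
      \sum_o' cmass p o' * (hybrid D (upd W e o) (upd W' e o') V)%:R)))).
    apply: le_expect => // W; apply: le_expect => // W'.
    rewrite [leRHS](expect_resample e) ?cmass1 //.
    by apply: le_expect => // V; apply: hybrid_resample.
  move=> W; under eq_bigr => o _.
    rewrite (expect_resample e) ?cmass1 // -expectZ; over.
  rewrite -expect_sum; apply: eq_expect => W'.
  under eq_bigr => o _.
    under eq_bigr => o' _ do rewrite -expectZ.
    rewrite -expect_sum -expectZ; over.
  by rewrite -expect_sum.
have steps s : uniq s -> P set0 <= P [set x in s].
  elim: s => [|e s IH] /=; first by rewrite set_nil.
  case/andP=> es us; apply: (le_trans (IH us)); rewrite set_cons.
  by apply: step; rewrite inE.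
have := steps _ (enum_uniq E).
rewrite (_ : [set x in enum E] = setT); last first.
  by apply/setP=> x; rewrite !inE mem_enum.
have hT W W' V : hybrid setT W W' V = [exists w, S w \subset gr V].
  apply: eq_existsb => w; apply/forall_inP/subsetP => h x xS.
    by have := h x xS; rewrite /hits inE.
  by rewrite /hits inE h.
have h0 W W' V : hybrid set0 W W' V = [exists w, S w \subset gr W :|: gr W'].
  apply: eq_existsb => w; apply/forall_inP/subsetP => h x xS.
    by have := h x xS; rewrite /hits !inE.
  by have := h x xS; rewrite /hits !inE.
rewrite /P => h; apply: le_trans (le_trans h _).
  rewrite le_eqVlt; apply/orP; left; apply/eqP.
  apply: eq_expect => W; apply: eq_expect => W'.
  rewrite (@eq_expect _ _ _ _ _ (fun=> [exists w, S w \subset gr W :|: gr W']%:R)).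
    by rewrite expect_cst ?cmass1.
  by move=> V; rewrite h0.
rewrite le_eqVlt; apply/orP; left; apply/eqP.
rewrite (@eq_expect _ _ _ _ _ (fun=>
  expect (cmass (2 * p)) (fun V => [exists w, S w \subset gr V]%:R))).
  by rewrite expect_cst ?cmass1.
move=> W; rewrite (@eq_expect _ _ _ _ _ (fun=>
  expect (cmass (2 * p)) (fun V => [exists w, S w \subset gr V]%:R))).
  by rewrite expect_cst ?cmass1.
by move=> W'; apply: eq_expect => V; rewrite hT.
Qed.

End Hybrid.

(** * Fragments *)

Definition cov A : R := #|[set w | A \subset S w]|%:R / #|Om|%:R.

Lemma cov_ge0 A : 0 <= cov A.
Proof. by rewrite divr_ge0. Qed.

Definition frag w W : {set E * C} :=
  S [arg min_(w' < w | S w' \subset S w :|: gr W) #|S w' :\: gr W|] :\: gr W.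

Variant frag_spec w W : {set E * C} -> Type :=
  FragSpec w' of S w' \subset S w :|: gr W &
    (forall v, S v \subset S w :|: gr W -> #|S w' :\: gr W| <= #|S v :\: gr W|)%N :
    frag_spec w W (S w' :\: gr W).

Lemma fragP w W : frag_spec w W (frag w W).
Proof.
rewrite /frag; case: arg_minnP => [|w' hw' hmin]; first exact: subsetUl.
exact: FragSpec.
Qed.

Lemma frag_sub w W : frag w W \subset S w.
Proof. by case: fragP => w' hw' _; rewrite subDset setUC. Qed.

Lemma frag_gr_cover w W W' : frag w W \subset gr W' ->
  [exists v, S v \subset gr W :|: gr W'].
Proof. by case: fragP => w' _ _; rewrite subDset => h; apply/existsP; exists w'. Qed.

Definition selected Z : {set E * C} :=
  if [pick w | S w \subset gr Z] is Some w then S w else set0.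

(* The fragment can be read off inside the member selected from the overwritten
   colouring: this is what makes the union bound in [first_round] cheap. *)
Lemma frag_selected w W :
  frag w W \subset selected (overwrite (enum (frag w W)) W).
Proof.
case: fragP => w' hw' hmin; set T := S w' :\: gr W.
have fT : functional T by move=> x y /setDP[xS _] /setDP[yS _]; exact: funS xS yS.
have memZ e c : ((e, c) \in gr (overwrite (enum T) W)) =
    ((e, c) \in T) || ((e \notin unzip1 (enum T)) && ((e, c) \in gr W)).
  by rewrite mem_gr_overwrite ?functional_uniq // mem_enum.
rewrite /selected; case: pickP => [v hv|/(_ w')]; last first.
  suff -> : S w' \subset gr (overwrite (enum T) W) by [].
  apply/subsetP=> -[e c] xS; rewrite memZ !in_setD xS andbT.
  case: (boolP ((e, c) \in gr W)) => //= xW; rewrite andbT.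
  apply/mapP=> -[[e1 c1]]; rewrite mem_enum => /setDP[yS yW] /= ee.
  by move: yW; rewrite -(funS xS yS ee) xW.
have gZ : gr (overwrite (enum T) W) \subset T :|: gr W.
  apply/subsetP=> -[e c]; rewrite memZ in_setU.
  by case/orP=> [->//|/andP[_ ->]]; rewrite orbT.
have vT : S v :\: gr W \subset T.
  by rewrite subDset setUC (subset_trans hv gZ).
have Tw : T \subset S w by rewrite subDset setUC.
(* The selected member competes in the minimum defining the fragment, so it leaves at least as much
   outside [W]. *)
have le : (#|T| <= #|S v :\: gr W|)%N.
  apply: hmin; apply: (subset_trans hv); apply: (subset_trans gZ).
  exact: setSU.
have -> : T = S v :\: gr W.
  by apply/eqP; rewrite eq_sym eqEcard vT le.
exact: subsetDl.
Qed.

(** * The two rounds, driven by sums over subsets of one member *)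

Hypothesis Om0 : (0 < #|Om|)%N.

Let N0 : #|Om|%:R != 0 :> R.
Proof. by rewrite pnatr_eq0 -lt0n. Qed.

Variable p : R.
Hypotheses (p0 : 0 < p) (p1 : p <= 1).

Local Notation x := (#|C|%:R / p).

Let x0 : 0 < x.
Proof. by rewrite divr_gt0 // ltr0n. Qed.

Let m0 o : 0 <= @cmass R C p o.
Proof. by rewrite cmass_ge0 // ltW. Qed.

Variables (t : nat) (d1 d2 : R).
Hypotheses (d10 : 0 <= d1) (d20 : 0 <= d2).
Hypothesis H1 : forall w,
  \sum_(A : {set E * C} | (A \subset S w) && (t < #|A|)%N) x ^+ #|A| * cov A <= d1.
Hypothesis H2 : forall w (T : {set E * C}), T \subset S w -> (#|T| <= t)%N ->
  \sum_(A : {set E * C} | (A \subset T) && (A != set0)) x ^+ #|A| * cov A <= d2.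

Definition bad W : {set Om} := [set w | (t < #|frag w W|)%N].

(** Union bound over the value [A] of the fragment. By [frag_selected] it lies in the member
    selected from the overwritten colouring, and a change of measure replaces that colouring by a
    plain sample [Z] at cost [x ^+ #|A|]. For each [Z] there remains the sum in [H1]. *)
Lemma first_round :
  expect (cmass p) (fun W => #|bad W|%:R / #|Om|%:R) <= d1.
Proof.
apply: (@le_trans _ _ (expect (cmass p) (fun W =>
  \sum_(A : {set E * C} | (t < #|A|)%N)
     cov A * (A \subset selected (overwrite (enum A) W))%:R))).
  apply: le_expect => // W.
  rewrite /bad -sum1dep_card natr_sum.
  rewrite (partition_big (frag^~ W) (fun A => t < #|A|)%N) //=.
  rewrite mulr_suml; apply: ler_sum => A tA.
  rewrite /cov mulrAC ler_wpM2r // ?invr_ge0 //.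
  rewrite -sum1dep_card natr_sum mulr_suml.
  rewrite [leRHS](bigID (fun w => frag w W == A)) /= ler_wpDr //.
    by apply: sumr_ge0 => w _; rewrite mulr_ge0.
  rewrite [leRHS](eq_bigl (fun w => (t < #|frag w W|)%N && (frag w W == A))).
    apply: ler_sum => w /andP[_ /eqP <-].
    by rewrite frag_selected mulr1.
  move=> w; case: eqP => [eA|]; rewrite ?andbF // !andbT.
  by rewrite eA tA -[in LHS]eA frag_sub.
rewrite expect_sum.
have hA (A : {set E * C}) : expect (cmass p) (fun W =>
    cov A * (A \subset selected (overwrite (enum A) W))%:R) <=
    expect (cmass p) (fun Z => x ^+ #|A| * cov A * (A \subset selected Z)%:R).
  case: (boolP [exists w, A \subset S w]) => [/existsP[w Aw]|no].
    have fA : functional A.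
      by move=> y z yA zA; apply: (@funS w); exact: (subsetP Aw).
    rewrite expectZ (expect_overwrite_set (fun Z => (A \subset selected Z)%:R)) //.
    rewrite expectZ mulrCA mulrA ler_wpM2l ?(mulr_ge0 (exprn_ge0 _ (ltW x0)) (cov_ge0 A)) //.
    by apply: le_expect => // Z; rewrite -natrM ler_nat mulnb; case: (A \subset gr Z).
  have -> : cov A = 0.
    rewrite /cov (_ : [set w | _] = set0) ?cards0 ?mul0r //.
    apply/setP=> w; rewrite !inE; apply/negbTE; apply: contra no => h.
    by apply/existsP; exists w.
  by rewrite mulr0; apply: le_expect => // W; rewrite !mul0r.
apply: (le_trans (ler_sum _ (fun A _ => hA A))).
rewrite -expect_sum -[leRHS](@expect_cst R E (option C) (cmass p) d1) ?cmass1 //.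
apply: le_expect => // Z.
rewrite (bigID (fun A : {set E * C} => A \subset selected Z)) /=.
rewrite [X in _ + X]big1 ?addr0 => [|A /andP[_ /negbTE->]]; last by rewrite mulr0.
rewrite (eq_bigr (fun A => x ^+ #|A| * cov A)) => [|A /andP[_ ->]]; last by rewrite mulr1.
rewrite (eq_bigl (fun A => (A \subset selected Z) && (t < #|A|)%N)); last first.
  by move=> A; rewrite andbC.
rewrite /selected; case: pickP => [w _|_]; first exact: H1.
(* With no member to select, [A] would be empty, which [t < #|A|] forbids. *)
rewrite big1 // => A /andP[]; rewrite subset0 => /eqP->.
by rewrite cards0.
Qed.

(** [X] counts the good [w] whose fragment appears, weighted so that each has mean [#|Om|%:R^-1]. A
    pair contributes at most [x] to the size of the overlap of its fragments: the constant 1 adds up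
    to [g ^+ 2], and the excess of overlapping pairs to at most [d2]. *)
Lemma second_moment W :
  let good := ~: bad W in
  let X W' : R := #|Om|%:R^-1 *
    \sum_(w in good) x ^+ #|frag w W| * (frag w W \subset gr W')%:R in
  let g : R := #|good|%:R / #|Om|%:R in
  expect (cmass p) X = g /\ expect (cmass p) (fun W' => X W' ^+ 2) <= g ^+ 2 + d2.
Proof.
move=> good X g.
have xn0 k : x ^+ k != 0 by rewrite expf_neq0 // gt_eqF.
have fT w : functional (frag w W).
  by move=> y z yA zA; apply: (@funS w); apply: (subsetP (frag_sub w W)).
split.
  rewrite /X expectZ expect_sum (eq_bigr (fun=> 1)) => [|w _]; last first.
    by rewrite expectZ prob_subset // divff.
  by rewrite sumr_const mulrC.
rewrite (@eq_expect _ _ _ _ _ (fun W' => #|Om|%:R ^- 2 *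
   \sum_(w in good) \sum_(v in good) x ^+ #|frag w W| * x ^+ #|frag v W| *
     ((frag w W \subset gr W')%:R * (frag v W \subset gr W')%:R))); last first.
  move=> W'; rewrite /X exprMn exprVn; congr (_ * _).
  rewrite expr2 mulr_suml; apply: eq_bigr => w _; rewrite mulr_sumr.
  by apply: eq_bigr => v _; rewrite mulrACA.
rewrite expectZ expect_sum.
(* A nonempty overlap is itself one of the sets [A], since [frag v W] lies in [S v]. Allowing all
   [A] lets the sum over [v] produce [cov A]. *)
apply: (@le_trans _ _ (#|Om|%:R ^- 2 * \sum_(w in good) \sum_(v in good)
   (1 + \sum_(A : {set E * C} | (A \subset frag w W) && (A != set0))
          x ^+ #|A| * (A \subset S v)%:R))).
  rewrite ler_wpM2l ?invr_ge0 ?exprn_ge0 //; apply: ler_sum => w wg.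
  rewrite expect_sum; apply: ler_sum => v vg; rewrite expectZ.
  have h := @prob_subset2 R _ _ p (frag w W) (frag v W) C0 p0.
  apply: (@le_trans _ _ (x ^+ #|frag w W :&: frag v W|)).
    apply: (le_trans (ler_wpM2l _ h)); first by rewrite mulr_ge0 // exprn_ge0 // ltW.
    by rewrite mulrA mulrACA !divff // !mul1r.
  have [->|I0] := eqVneq (frag w W :&: frag v W) set0.
    rewrite cards0 expr0 lerDl sumr_ge0 // => A _.
    by rewrite mulr_ge0 // exprn_ge0 // ltW.
  rewrite (bigD1 (frag w W :&: frag v W)) /= ?subsetIl //.
  rewrite (subset_trans (subsetIr _ _)) ?frag_sub // mulr1 addrCA lerDl.
  rewrite addr_ge0 // sumr_ge0 // => A _.
  by rewrite mulr_ge0 // exprn_ge0 // ltW.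
have -> : g ^+ 2 + d2 = #|Om|%:R ^- 2 * (#|good|%:R ^+ 2 + #|Om|%:R ^+ 2 * d2).
  by rewrite /g; field; exact: N0.
rewrite ler_wpM2l ?invr_ge0 ?exprn_ge0 //.
under eq_bigr do rewrite big_split /= sumr_const.
rewrite big_split /= sumr_const -mulrnA natrM -expr2 lerD2l.
have inner w : w \in good -> \sum_(v in good)
    \sum_(A : {set E * C} | (A \subset frag w W) && (A != set0))
      x ^+ #|A| * (A \subset S v)%:R <= #|Om|%:R * d2.
  move=> wg; rewrite exchange_big /=.
  have hT : (#|frag w W| <= t)%N by move: wg; rewrite !inE -leqNgt.
  have h := H2 (frag_sub w W) hT.
  apply: le_trans (ler_wpM2l (ler0n R #|Om|) h).
  rewrite mulr_sumr; apply: ler_sum => A _; rewrite -mulr_sumr mulrCA.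
  rewrite ler_wpM2l ?exprn_ge0 ?(ltW x0) // /cov mulrC divfK // -natr_sum ler_nat.
  rewrite -sum1dep_card big_mkcond [leqRHS]big_mkcond /=.
  by apply: leq_sum => v _; case: ifP => //; case: ifP.
apply: (le_trans (ler_sum _ inner)).
rewrite sumr_const -[leLHS]mulr_natl mulrA ler_wpM2r // expr2 ler_wpM2r // ler_nat.
exact: max_card.
Qed.

(** Chebyshev's inequality: where no member appears, [X] vanishes and [(X - g) ^+ 2] equals
    [g ^+ 2], so that [g ^+ 2 * (1 - P) <= d2]. *)
Lemma second_round W :
  1 - 2 * (#|bad W|%:R / #|Om|%:R) - 4 * d2 <=
  expect (cmass p) (fun W' => [exists w, S w \subset gr W :|: gr W']%:R).
Proof.
set B : R := _ / _; set P := expect _ _.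
have P0 : 0 <= P.
  by rewrite /P -(@expect_cst R E (option C) (cmass p) 0) ?cmass1 //; apply: le_expect.
(* If [B >= 1 / 2] the left side is at most 0. Otherwise [g > 1 / 2], which is where the constant 4
   comes from. *)
have [B12|B12] := leP (1 / 2) B; first by move: d20 P0 B12; lra.
have [] := second_moment W.
set good := ~: bad W; set X := (fun W' => _); set g : R := _ / _ => EX EX2.
have gE : g = 1 - B.
  have := cardsC (bad W); rewrite -/good => h.
  rewrite /g /B; apply: (mulIf N0); rewrite mulrBl !divfK // mul1r -h natrD.
  by rewrite addrAC subrr add0r.
have : g ^+ 2 * (1 - P) <= d2.
  apply: (@le_trans _ _ (expect (cmass p)
      (fun W' => X W' ^+ 2 + (- (2 * g) * X W' + g ^+ 2)))); last first.
    by rewrite expectD expectD expectZ EX expect_cst ?cmass1 //; nra.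
  have -> : g ^+ 2 * (1 - P) = expect (cmass p) (fun W' => g ^+ 2 +
      - g ^+ 2 * [exists w, S w \subset gr W :|: gr W']%:R).
    by rewrite expectD expect_cst ?cmass1 // expectZ -/P; ring.
  apply: le_expect => // W'.
  rewrite (_ : _ + (_ + _) = (X W' - g) ^+ 2); last by ring.
  case: (boolP [exists w, _]) => h; first by rewrite mulr1 subrr sqr_ge0.
  rewrite mulr0 addr0 /X big1 ?mulr0 ?sub0r ?sqrrN // => w _.
  case: (boolP (frag w W \subset gr W')) => [/frag_gr_cover h'|].
    by rewrite h' in h.
  by rewrite mulr0.
rewrite gE => h; have : 1 / 4 * (1 - P) <= (1 - B) ^+ 2 * (1 - P).
  apply: ler_wpM2r; last by move: B12; nra.
  rewrite subr_ge0 -[leRHS](@expect_cst R E (option C) (cmass p) 1) ?cmass1 //.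
  by apply: le_expect => // W'; rewrite lern1 leq_b1.
have B0 : 0 <= B by rewrite divr_ge0.
by move: h B0; lra.
Qed.

Lemma two_rounds : 2 * p <= 1 ->
  1 - 2 * d1 - 4 * d2 <=
  expect (cmass (2 * p)) (fun V => [exists w, S w \subset gr V]%:R).
Proof.
move=> p2; apply: le_trans (two_rounds_le (ltW p0) p2).
apply: le_trans (le_expect m0 second_round).
rewrite (@eq_expect _ _ _ _ _ (fun W => (1 - 4 * d2) + (- 2) * (#|bad W|%:R / #|Om|%:R))).
  rewrite expectD expectZ expect_cst ?cmass1 //; have := first_round; lra.
by move=> W; ring.
Qed.

End Families.

(** * Counting permutations constrained along a forest *)

Section PermCount.
Variable T : finType.
Implicit Types (s : {perm T}) (Q : {set {perm T}}) (V : {set T}).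

(** Composed with the inverse of one solution [s0], every solution becomes a permutation fixing [V]
    pointwise. *)
Lemma card_perm_agree V (f : T -> T) :
  (#|[set s : {perm T} | [forall x in V, s x == f x]]| <= (#|T| - #|V|)`!)%N.
Proof.
set A := [set s | _].
have [->|[s0]] := set_0Vmem A; first by rewrite cards0.
rewrite inE => /forall_inP h0.
have -> : (#|T| - #|V| = #|~: V|)%N by rewrite [RHS]cardsCs setCK.
rewrite -card_perm.
rewrite -(card_imset (mem A) (@mulIg _ (s0^-1)%g)).
apply/subset_leq_card/subsetP => _ /imsetP[s + ->].
rewrite inE => /forall_inP hs; apply/subsetP=> x.
rewrite !inE; apply: contra => xV; rewrite permM.
by rewrite (eqP (hs x xV)) -(eqP (h0 x xV)) permK.
Qed.

(** The restriction of [s] to [V], padded with [None] so that restrictions to different sets have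
    one type. *)
Definition pattern V s : {ffun T -> option T} :=
  [ffun x => if x \in V then Some (s x) else None].

Lemma card_patterns Q V :
  (#|Q| <= #|[set pattern V s | s in Q]| * (#|T| - #|V|)`!)%N.
Proof.
rewrite -sum1_card (partition_big_imset (pattern V)) /= -sum_nat_const.
apply: leq_sum => _ /imsetP[s0 s0Q ->]; rewrite sum1dep_card.
apply: leq_trans (card_perm_agree V s0).
apply/subset_leq_card/subsetP => s; rewrite !inE => /andP[_ /eqP/ffunP h].
by apply/forall_inP=> x xV; have := h x; rewrite !ffunE xV => -[->].
Qed.

Lemma card_patternsU Q V (o : T) D :
  (forall y, #|[set s o | s : {perm T} in [set s in Q | pattern V s == y]]| <= D)%N ->
  (#|[set pattern (o |: V) s | s in Q]| <= #|[set pattern V s | s in Q]| * D)%N.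
Proof.
move=> hD; pose g s := (pattern V s, s o).
pose h (z : {ffun T -> option T} * T) : {ffun T -> option T} :=
  [ffun x => if x == o then Some z.2 else z.1 x].
have -> : [set pattern (o |: V) s | s in Q] = [set h z | z in [set g s | s in Q]].
  rewrite -imset_comp; apply: eq_imset => s; apply/ffunP=> x.
  by rewrite !ffunE !inE; case: eqP => [->|].
apply: (leq_trans (leq_imset_card _ _)).
rewrite -sum1_card (partition_big fst (mem [set pattern V s | s in Q])) /=; last first.
  by move=> _ /imsetP[s sQ ->]; apply: imset_f.
rewrite -sum_nat_const; apply: leq_sum => y _; rewrite sum1dep_card.
apply: leq_trans (hD y).
rewrite -[leqRHS](card_imset _ (fun u v (e : (y, u) = (y, v)) => congr1 snd e)).
apply/subset_leq_card/subsetP => -[y1 u]; rewrite inE /=.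
case/andP=> /imsetP[s sQ [-> ->]] /eqP ey; apply/imsetP; exists (s o).
  by apply/imsetP; exists s; rewrite // inE sQ ey eqxx.
by rewrite ey.
Qed.

Definition verts (B : seq (T * T)) : {set T} :=
  [set x in unzip1 B ++ unzip2 B].

(* The first endpoint of each edge is fresh with respect to the later edges. *)
Fixpoint forest (B : seq (T * T)) : bool :=
  if B is b :: B' then [&& b.1 \notin verts B', b.1 != b.2 & forest B'] else true.

Lemma verts_cons o a B : verts ((o, a) :: B) = o |: (a |: verts B).
Proof.
apply/setP=> x; rewrite !inE /= !mem_cat !inE.
by case: (x == o) => //=; case: (x == a); rewrite ?orbT.
Qed.

(** Vertices are placed from the end of [B]. The fresh endpoint of an edge has at most [D] places
    once the other endpoint is placed, and every other vertex at most [#|T|]. The factor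
    [#|T| ^ size B] avoids the subtraction [#|verts B| - size B]. *)
Lemma card_forest_patterns Q B (rl : rel T) D : forest B ->
  (forall s, s \in Q -> all (fun b => rl (s b.1) (s b.2)) B) ->
  (forall v, #|[set u | rl u v]| <= D)%N ->
  (#|[set pattern (verts B) s | s in Q]| * #|T| ^ size B
     <= #|T| ^ #|verts B| * D ^ size B)%N.
Proof.
move=> + + hD; elim: B => [|[o a] B IH] /= fB hQ.
  rewrite !expn0 !muln1 (leq_trans _ (_ : 1 <= _)%N) //; last first.
    by rewrite (_ : verts [::] = set0) ?cards0 //; apply/setP => x; rewrite !inE.
  rewrite -(cards1 (pattern (verts [::]) 1%g)).
  apply/subset_leq_card/subsetP=> _ /imsetP[s _ ->]; rewrite inE; apply/eqP.
  by apply/ffunP=> x; rewrite !ffunE !inE.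
case/and3P: fB => oB oa fB.
have {}IH := IH fB (fun s sQ => proj2 (andP (hQ s sQ))).
rewrite verts_cons cardsU1 !inE /= (negbTE oa) /=.
have -> : o \notin unzip1 B ++ unzip2 B by move: oB; rewrite inE.
set V1 := a |: verts B.
have IH1 : (#|[set pattern V1 s | s in Q]| * #|T| ^ size B
     <= #|T| ^ #|V1| * D ^ size B)%N.
  case: (boolP (a \in verts B)) => aB.
    by rewrite /V1 (setUidPr _) // sub1set.
  rewrite /V1 cardsU1 aB expnS -mulnA.
  apply: leq_trans (leq_mul (leqnn #|T|) IH).
  rewrite mulnA leq_mul2r mulnC; apply/orP; right.
  rewrite mulnC (mulnC #|T|); apply: card_patternsU => y; exact: max_card.
apply: (@leq_trans (#|[set pattern V1 s | s in Q]| * D * #|T| ^ (size B).+1)).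
  rewrite leq_mul2r; apply/orP; right; apply: card_patternsU => y.
  case: (set_0Vmem [set s in Q | pattern V1 s == y]) => [->|[s0]].
    by rewrite imset0 cards0.
  rewrite inE => /andP[s0Q /eqP s0y]; apply: leq_trans (hD (s0 a)).
  apply/subset_leq_card/subsetP=> _ /imsetP[s + ->].
  rewrite !inE => /andP[sQ /eqP sy].
  have := hQ s sQ => /andP[/= + _].
  have : pattern V1 s a = pattern V1 s0 a by rewrite sy s0y.
  by rewrite !ffunE !inE eqxx /= => -[->].
rewrite add1n !expnS.
move: IH1; move: (#|_|) (#|T| ^ size B)%N (#|T| ^ #|V1|)%N (D ^ size B)%N => u x y z IH1.
have -> : (u * D * (#|T| * x) = #|T| * D * (u * x))%N by ring.
have -> : (#|T| * y * (D * z) = #|T| * D * (y * z))%N by ring.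
by rewrite leq_mul2l IH1 orbT.
Qed.

Lemma card_verts B : (#|verts B| <= 2 * size B)%N.
Proof.
rewrite /verts cardsE (leq_trans (card_size _)) //.
by rewrite size_cat !size_map mul2n addnn.
Qed.

End PermCount.

(** * From factorials to powers *)

Section RealCount.
Variable R : realType.
Notation e := (expR (1 : R)).

(** Induction on [n]: raising the base from [n.+1] to [n.+2] costs [(n.+2%:R / n.+1%:R) ^+ v], at
    most [e] because [v <= n.+1]. *)
Lemma expn_le_ffact n v : (v <= n)%N ->
  n%:R ^+ v <= e ^+ v * (n ^_ v)%:R :> R.
Proof.
elim: n v => [|n IH] [|v] //; rewrite ?expr0 ?ffactn0 ?mul1r //.
rewrite ltnS => vn; have {}IH := IH v vn.
case: n vn IH => [|n] vn IH.
  move: vn; rewrite leqn0 => /eqP->; rewrite !expr1 ffactn1 mulr1.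
  by apply: le_trans (expR_ge1Dx _); rewrite lerDl.
rewrite ffactSS exprSr natrM.
have h : (n.+2%:R / n.+1%:R) ^+ v <= e :> R.
  have h1 : n.+2%:R / n.+1%:R <= expR (n.+1%:R^-1) :> R.
    apply: le_trans (expR_ge1Dx _); rewrite -natr1 mulrDl divff ?pnatr_eq0 //.
    by rewrite mul1r.
  apply: (@le_trans _ _ (expR (n.+1%:R^-1) ^+ v)).
    by rewrite lerXn2r ?nnegrE ?divr_ge0 ?expR_ge0.
  rewrite -expRM_natl ler_expR -mulr_natl mulr1 ler_pdivrMr ?ltr0n //.
  by rewrite mul1r ler_nat.
have -> : n.+2%:R ^+ v = n.+1%:R ^+ v * (n.+2%:R / n.+1%:R) ^+ v :> R.
  by rewrite -exprMn mulrCA divff ?mulr1 // pnatr_eq0.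
apply: (@le_trans _ _ (e ^+ v * (n.+1 ^_ v)%:R * e * n.+2%:R)).
  rewrite ler_wpM2r // ler_pM // ?exprn_ge0 // divr_ge0 //.
by rewrite le_eqVlt [in X in _ == X]exprSr; apply/orP; left; apply/eqP; ring.
Qed.

Lemma fact_sub_le n v : (v <= n)%N ->
  (n - v)`!%:R * n%:R ^+ v <= e ^+ v * n`!%:R :> R.
Proof.
move=> vn; rewrite -(ffact_fact vn) natrM mulrA mulrC ler_wpM2r //.
exact: expn_le_ffact.
Qed.

(** A forest spans at most twice as many vertices as it has edges, and each vertex costs a factor
    [e] when a factorial is compared with a power; hence [e ^+ 2] per edge. *)
Lemma card_forest_perm (T : finType) (Q : {set {perm T}}) (B : seq (T * T))
    (rl : rel T) D : forest B -> (0 < #|T|)%N ->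
  (forall s, s \in Q -> all (fun b => rl (s b.1) (s b.2)) B) ->
  (forall v, #|[set u | rl u v]| <= D)%N ->
  #|Q|%:R <= (e ^+ 2 * D%:R / #|T|%:R) ^+ size B * #|T|`!%:R :> R.
Proof.
move=> fB T0 hQ hD; have h := card_forest_patterns fB hQ hD.
have n0 : 0 < #|T|%:R :> R by rewrite ltr0n.
have hv : (#|verts B| <= #|T|)%N by rewrite max_card.
have e1 : 1 <= e by apply: le_trans (expR_ge1Dx _); rewrite lerDl.
have h2 := fact_sub_le hv.
rewrite expr_div_n mulrAC ler_pdivlMr ?exprn_gt0 //.
have h1 := card_patterns Q (verts B).
apply: (@le_trans _ _ ((#|T| - #|verts B|)`!%:R * (#|T|%:R ^+ #|verts B| * D%:R ^+ size B))).
  rewrite -!natrX -!natrM ler_nat.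
  apply: (leq_trans (leq_mul h1 (leqnn _))).
  by rewrite mulnAC mulnC leq_mul2l h orbT.
rewrite mulrA exprMn -exprM.
apply: (@le_trans _ _ (e ^+ #|verts B| * #|T|`!%:R * D%:R ^+ size B)).
  by rewrite ler_wpM2r ?exprn_ge0.
rewrite mulrAC !ler_wpM2r ?exprn_ge0 //.
by rewrite ler_weXn2l ?card_verts.
Qed.

End RealCount.

(** * Chains of active positions and the forests they carry *)

Section Chains.
Variable r : nat.
Implicit Types (h : nat -> nat).
Local Open Scope nat_scope.

Definition active h k := (r <= k) && (0 < h k).

(* [h k] is the number of edges sent back by position k. Positions below r are
   never active, as their edges may wrap around. [reach h k] is positive exactly
   when one of the r positions before k is active. *)
Fixpoint reach h k : nat :=
  if k is k'.+1 then if active h k' then r else (reach h k').-1 else 0.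

Fixpoint rho h k : nat :=
  if k is k'.+1 then
    rho h k' + (if active h k' then if reach h k' == 0 then h k' else 1 else 0)
  else 0.

Lemma eq_reach h h' k : (forall j, j < k -> h j = h' j) -> reach h k = reach h' k.
Proof.
elim: k => //= k IH hh; rewrite /active hh // IH // => j jk; apply: hh.
exact: ltnW.
Qed.

Lemma eq_rho h h' k : (forall j, j < k -> h j = h' j) -> rho h k = rho h' k.
Proof.
elim: k => //= k IH hh; rewrite /active hh // IH ?(@eq_reach h h') // => j jk.
  by apply: hh; exact: ltnW.
by apply: hh; exact: ltnW.
Qed.

Lemma reach_le h k : reach h k <= r.
Proof.
by elim: k => //= k IH; case: ifP => // _; exact: leq_trans (leq_pred _) IH.
Qed.

Variable n : nat.
Implicit Types (L U : {set 'I_n * 'I_r}).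

Definition rowsize L (k : nat) : nat := #|[set x in L | x.1 == k :> nat]|.

Lemma rowsizeE L (i : 'I_n) : rowsize L i = #|[set d | (i, d) \in L]|.
Proof.
have inj : injective (fun d : 'I_r => (i, d)) by move=> u v [].
rewrite /rowsize -[RHS](card_imset _ inj).
apply: eq_card => -[j d]; rewrite inE /=; apply/andP/imsetP.
  by case=> h /eqP/val_inj e; exists d; rewrite ?inE -e.
by case=> d'; rewrite inE => h [-> ->].
Qed.

Lemma rowsize_le L k : rowsize L k <= r.
Proof.
rewrite /rowsize -[leqRHS]card_ord -(card_in_imset (f := snd)) ?max_card //.
move=> [i d] [j d']; rewrite !inE /= => /andP[_ /eqP e] /andP[_ /eqP e'] ->.
by congr pair; apply: val_inj; rewrite /= e e'.
Qed.

(** Both orientations occur because [forest] wants the fresh endpoint first. The sums are taken in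
    [nat], which excludes edges that wrap around. *)
Definition linked L (b : 'I_n * 'I_n) : bool :=
  [exists x in L, (b.1 == x.1 :> nat) && (b.2 + x.2.+1 == x.1)
               || (b.2 == x.1 :> nat) && (b.1 + x.2.+1 == x.1)].

(** The invariant keeps the vertices used so far below [k - r + reach]. When the reach is 0, the [r]
    positions before [k] are therefore all fresh, and every edge sent back by [k] joins the forest;
    otherwise only [k] itself is known to be fresh, and one edge is added. *)
Lemma rho_forest L k : k <= n -> exists B : seq ('I_n * 'I_n),
  [/\ forest B, size B = rho (rowsize L) k, all (linked L) B &
      forall v, v \in verts B -> v + r < k + reach (rowsize L) k].
Proof.
elim: k => [|k IH] kn.
  by exists [::]; split => // v; rewrite inE.
have [B [fB sB lB vB]] := IH (ltnW kn).
rewrite [rho _ k.+1]/= [reach _ k.+1]/=; case: ifP => [|_]; last first.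
  by exists B; split; rewrite ?addn0 // => v /vB; lia.
pose i := Ordinal kn; case/andP=> rk; rewrite [rowsize L k](rowsizeE L i) => ik.
have cr := reach_le (rowsize L) k.
case: ifP => [/eqP c0|/negbT c0]; last first.
  case/card_gt0P: ik => d; rewrite inE => idL.
  have an : k - d.+1 < n by lia.
  have dr : d < r by [].
  (* The new position is the fresh endpoint. *)
  exists ((i, Ordinal an) :: B); split.
  - rewrite /= fB andbT -val_eqE /=.
    apply/andP; split; last by lia.
    by apply/negP => /vB /=; lia.
  - by rewrite /= sB addn1.
  - rewrite /= lB andbT; apply/existsP; exists (i, d); rewrite idL /=.
    by apply/orP; left; rewrite eqxx /=; lia.
  move=> v; rewrite verts_cons !in_setU1 => /or3P[/eqP->|/eqP->|/vB] /=; lia.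
rewrite cardE; set ds := enum _.
have hds d : d \in ds -> (i, d) \in L by rewrite mem_enum inE.
have uds : uniq ds := enum_uniq _.
move: ds hds uds {ik} => ds.
suff H : (forall d, d \in ds -> (i, d) \in L) -> uniq ds ->
  exists B' : seq ('I_n * 'I_n), [/\ forest B', size B' = size B + size ds,
    all (linked L) B' & forall v, v \in verts B' ->
      [\/ v \in verts B, v = i | exists2 d, d \in ds & v + d.+1 = k]].
  move=> hds uds; have [B' [fB' sB' lB' vB']] := H hds uds.
  exists B'; split=> //; first by rewrite sB' sB.
  by move=> v /vB' [/vB|->|[d _]]; rewrite /=; lia.
elim: ds => [|d ds IHd] hds /=.
  by exists B; split; rewrite ?addn0 // => v vv; constructor 1.
case/andP=> dds uds.
have [|B' [fB' sB' lB' vB']] := IHd _ uds.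
  by move=> d' hd; apply: hds; rewrite inE hd orbT.
have dr : d < r by [].
have an : k - d.+1 < n by lia.
(* Here the earlier position is the fresh endpoint, as [i] may be shared by several edges. *)
exists ((Ordinal an, i) :: B'); split.
- rewrite /= fB' andbT -val_eqE /=; apply/andP; split; last by lia.
  apply/negP=> /vB' [/vB /=|/(congr1 val) /=|[d' d'ds /=]]; try lia.
  have dr' : d' < r by [].
  move=> e; case/negP: dds; suff -> : d = d' by [].
  by apply: val_inj => /=; lia.
- by rewrite /= sB' addnS.
- rewrite /= lB' andbT; apply/existsP; exists (i, d).
  rewrite hds ?mem_head //=; apply/orP; right; rewrite eqxx /=; lia.
move=> v; rewrite verts_cons !in_setU1 => /or3P[/eqP->|/eqP->|/vB'].
- by constructor 3; exists d; rewrite ?mem_head //=; lia.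
- by constructor 2.
case=> [vv|->|[d' d'ds e]]; [by constructor 1|by constructor 2|].
by constructor 3; exists d'; rewrite // inE d'ds orbT.
Qed.

Lemma rho_le L k : rho (rowsize L) k <= #|L|.
Proof.
suff h : rho (rowsize L) k <= #|[set x in L | x.1 < k]|.
  by apply: leq_trans h _; apply: subset_leq_card; apply/subsetP => x; rewrite inE => /andP[].
elim: k => //= k IH.
have -> : #|[set x in L | x.1 < k.+1]| = #|[set x in L | x.1 < k]| + rowsize L k.
  rewrite /rowsize -cardsUI.
  rewrite [X in _ = _ + X](_ : _ = 0) ?addn0.
    apply: eq_card => x; rewrite !inE -andb_orr; congr (_ && _); lia.
  by apply/eqP; rewrite cards_eq0; apply/eqP/setP=> x; rewrite !inE; lia.
by apply: leq_add => //; rewrite /active; case: ifP => // /andP[_]; case: ifP.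
Qed.

End Chains.

(** * Summing over sets of labels, one position at a time *)

Lemma sum_subsetU (R : nmodType) (T : finType) (U1 U2 : {set T})
    (F : {set T} -> R) : [disjoint U1 & U2] ->
  \sum_(L : {set T} | L \subset U1 :|: U2) F L =
  \sum_(L1 : {set T} | L1 \subset U1) \sum_(L2 : {set T} | L2 \subset U2)
    F (L1 :|: L2).
Proof.
move=> dis; rewrite pair_big /=.
rewrite (reindex_onto (fun u : {set T} * {set T} => u.1 :|: u.2)
  (fun L => (L :&: U1, L :&: U2))) /=; last first.
  by move=> L LU; rewrite -setIUr (setIidPl LU).
apply: eq_bigl => -[L1 L2] /=; rewrite xpair_eqE !setIUl.
apply/and3P/andP => [[_ /eqP e1 /eqP e2]|[h1 h2]].
  split.
    by apply/subsetP=> x xL; move: (xL); rewrite -{1}e1 !inE; case/orP=> /andP[].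
  by apply/subsetP=> x xL; move: (xL); rewrite -{1}e2 !inE; case/orP=> /andP[].
rewrite setUSS // (setIidPl h1) (setIidPl h2).
have -> : L2 :&: U1 = set0.
  apply/eqP; rewrite setI_eq0 disjoint_sym.
  by apply: disjointWr dis.
have -> : L1 :&: U2 = set0 by apply/eqP; rewrite setI_eq0; apply: disjointWl dis.
by rewrite setU0 set0U.
Qed.

Section Weights.
Variables (R : realType) (r n : nat) (y b : R).
Hypotheses (r0 : (0 < r)%N) (y0 : 0 < y) (b1 : 1 <= b).
Let z : R := 2 ^+ r * y.
Hypothesis zr : 2 * r%:R * z <= 1.
Implicit Types (L U : {set 'I_n * 'I_r}).

(* A pending reach s is charged in advance for the active positions that the
   next s positions may add at cost 1 instead of b / b ^+ r. *)
Definition potential (s : nat) : R := 1 + s%:R * (2 * z).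

Definition weight k L : R :=
  (y * b) ^+ #|L| / b ^+ (r * rho r (rowsize L) k) * potential (reach r (rowsize L) k).

Definition below U k : {set 'I_n * 'I_r} := [set x in U | (x.1 < k)%N].

(** The growth allowed at position [k]. An empty row adds nothing, a position below [r] is bounded
    crudely since [rho] ignores it, and any other position pays only for starting a chain,
    continuations being prepaid by [potential]. *)
Definition factor U k : R :=
  if rowsize U k == 0%N then 1
  else if (k < r)%N then (2 * b) ^+ r else 1 + 2 * z * (b / b ^+ r).

Let b0 : 0 < b. Proof. exact: lt_le_trans b1. Qed.
Let z0 : 0 < z. Proof. by rewrite mulr_gt0 ?exprn_gt0. Qed.

Let z20 : 0 <= 2 * z. Proof. by rewrite mulr_ge0 // ltW. Qed.
Let theta0 : 0 <= b / b ^+ r.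
Proof. by rewrite divr_ge0 ?exprn_ge0 // ltW. Qed.

Let y1 : y <= 1.
Proof.
have : y <= 2 * r%:R * z.
  rewrite /z !mulrA ler_peMl ?(ltW y0) // -[leLHS]mulr1.
  rewrite ler_pM // ?exprn_ege1 ?ler1n //.
  have : 1 <= r%:R :> R by rewrite ler1n.
  lra.
by move/le_trans; apply.
Qed.

Lemma potential_ge1 s : 1 <= potential s.
Proof. by rewrite lerDl mulr_ge0 // mulr_ge0 // ltW. Qed.

Lemma potential_le s : (s <= r)%N -> potential s <= 2.
Proof.
move=> sr; have h : s%:R * (2 * z) <= 2 * r%:R * z.
  by rewrite mulrCA mulrA ler_wpM2r ?(ltW z0) // ler_wpM2l // ler_nat.
by move: (le_trans h zr); rewrite /potential; lra.
Qed.

Lemma potential_mono s s' : (s <= s')%N -> potential s <= potential s'.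
Proof. by move=> h; rewrite lerD2l ler_wpM2r ?ler_nat // mulr_ge0 // ltW. Qed.

Lemma factor_ge1 U k : 1 <= factor U k.
Proof.
rewrite /factor; case: ifP => // _; case: ifP => _.
  by rewrite exprn_ege1 //; move: b1; lra.
by rewrite lerDl (mulr_ge0 z20 theta0).
Qed.

(** With [shift], the recursion steps of [rho] and [reach], where the reach [s] and the row size [l]
    are free so that one row can be summed in isolation. *)
Definition increment (k s l : nat) : nat :=
  (if (r <= k) && (0 < l) then (if s == 0 then l else 1) else 0)%N.

Definition shift (k s l : nat) : nat := if (r <= k)%N && (0 < l)%N then r else s.-1.

(** The amortised step. An empty row lowers the pending reach, a nonempty one resets it to [r] and
    the potential to at most 2, and there are at most [2 ^+ r] choices of [D]. *)
Lemma sum_row (T : finType) (V : {set T}) k s : (#|V| <= r)%N -> (s <= r)%N ->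
  \sum_(D : {set T} | D \subset V)
    (y * b) ^+ #|D| / b ^+ (r * increment k s #|D|) * potential (shift k s #|D|)
  <= (if #|V| == 0%N then 1
      else if (k < r)%N then (2 * b) ^+ r else 1 + 2 * z * (b / b ^+ r)) *
     potential s.
Proof.
move=> Vr sr.
have ps0 u : 0 <= potential u by apply: le_trans (potential_ge1 u).
have cardV : (#|[set D : {set T} | D \subset V]| <= 2 ^ r)%N.
  by rewrite (_ : [set D : {set T} | _] = powerset V) ?card_powerset ?leq_exp2l.
case: eqP => [V0|_].
  have -> : V = set0 by apply/eqP; rewrite -cards_eq0; apply/eqP.
  rewrite (eq_bigl (pred1 set0)) => [|D]; last by rewrite subset0.
  rewrite big_pred1_eq /increment /shift cards0 ltnn andbF muln0 !expr0 divr1 !mul1r.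
  exact: (potential_mono (leq_pred s)).
have sum_le (c : R) (P : pred {set T}) (F : {set T} -> R) : 0 <= c ->
    (forall D : {set T}, D \subset V -> P D -> F D <= c) ->
    \sum_(D : {set T} | (D \subset V) && P D) F D <= 2 ^+ r * c.
  move=> c0 hF; apply: (@le_trans _ _ (\sum_(D : {set T} | (D \subset V) && P D) c)).
    by apply: ler_sum => D /andP[]; exact: hF.
  rewrite sumr_const -[leLHS]mulr_natl ler_wpM2r // -natrX ler_nat.
  apply: leq_trans cardV; apply: subset_leq_card.
  by apply/subsetP => D; rewrite !inE unfold_in => /andP[].
case: ltnP => kr.
  rewrite exprMn -mulrA (eq_bigl (fun D : {set T} => (D \subset V) && true)); last first.
    by move=> D; rewrite andbT.
  apply: sum_le => [|D DV _]; first by rewrite mulr_ge0 // exprn_ge0 // ltW.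
  rewrite /increment /shift leqNgt kr /= muln0 expr0 divr1.
  apply: ler_pM => //; first by rewrite exprn_ge0 // mulr_ge0 // ltW.
    rewrite exprMn -[leRHS]mul1r ler_pM ?exprn_ge0 ?(ltW y0) ?(ltW b0) //.
      by rewrite exprn_ile1 // ltW.
    by rewrite ler_weXn2l // (leq_trans _ Vr) // subset_leq_card.
  exact: (potential_mono (leq_pred s)).
rewrite (bigD1 set0) ?sub0set //=.
rewrite {1}/increment {1}/shift cards0 ltnn andbF muln0 !expr0 divr1 !mul1r.
have yl (D : {set T}) : D != set0 -> y ^+ #|D| <= y.
  by move=> D0; rewrite -[leRHS]expr1 ler_wiXn2l ?card_gt0 // ltW.
have pr : potential r <= 2 by apply: potential_le.
have y2 : 0 <= 2 * y by rewrite mulr_ge0 // ltW.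
(* A new chain: every label is a forest edge, so a nonempty [D] costs at most [y * (b / b ^+ r)]. *)
case: (posnP s) => [s0|s0].
  have h : \sum_(D : {set T} | (D \subset V) && (D != set0))
      (y * b) ^+ #|D| / b ^+ (r * increment k s #|D|) *
        potential (shift k s #|D|) <= 2 ^+ r * (2 * y * (b / b ^+ r)).
    apply: sum_le => [|D DV D0].
      by rewrite mulr_ge0 // divr_ge0 // ?exprn_ge0 // ltW.
    rewrite /increment /shift kr card_gt0 D0 s0 /= exprM.
    rewrite exprMn -[_ / _]mulrA -expr_div_n.
    rewrite (_ : 2 * y * _ = y * (b / b ^+ r) * 2); last by ring.
    rewrite ler_pM ?mulr_ge0 ?exprn_ge0 ?(ltW y0) //.
    rewrite ler_pM ?exprn_ge0 ?(ltW y0) ?yl //.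
    rewrite -[leRHS]expr1 ler_wiXn2l ?card_gt0 //.
    rewrite ler_pdivrMr ?exprn_gt0 // mul1r -[leLHS]expr1 ler_weXn2l //.
  apply: (@le_trans _ _ (potential 0 + 2 ^+ r * (2 * y * (b / b ^+ r)))).
    by rewrite lerD // s0 potential_mono.
  rewrite s0 /potential /z le_eqVlt; apply/orP; left; apply/eqP; ring.
(* A continued chain: [b ^+ #|D|] is cancelled by [b ^+ r], and the total [2 ^+ r * (2 * y)] is
   exactly the drop of [potential] from [s] to [s.-1]. *)
have h : \sum_(D : {set T} | (D \subset V) && (D != set0))
    (y * b) ^+ #|D| / b ^+ (r * increment k s #|D|) *
      potential (shift k s #|D|) <= 2 ^+ r * (2 * y).
  apply: sum_le => // D DV D0.
  rewrite /increment /shift kr card_gt0 D0 gtn_eqF //= muln1.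
  rewrite exprMn -[_ / _]mulrA.
  rewrite (_ : 2 * y = y * 1 * 2); last by ring.
  rewrite ler_pM ?mulr_ge0 ?invr_ge0 ?exprn_ge0 ?(ltW y0) ?(ltW b0) //.
  rewrite ler_pM ?mulr_ge0 ?invr_ge0 ?exprn_ge0 ?(ltW y0) ?(ltW b0) ?yl //.
  rewrite ler_pdivrMr ?exprn_gt0 // mul1r ler_weXn2l //.
  by apply: leq_trans Vr; exact: subset_leq_card.
apply: (@le_trans _ _ (potential s.-1 + 2 ^+ r * (2 * y))); first by rewrite lerD.
have -> : potential s.-1 + 2 ^+ r * (2 * y) = potential s.
  by rewrite /potential -{2}(prednK s0) -natr1 /z; ring.
by rewrite ler_peMl // lerDl (mulr_ge0 z20 theta0).
Qed.

Lemma sum_weight_step U (k : nat) :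
  \sum_(L : {set 'I_n * 'I_r} | L \subset below U k.+1) weight k.+1 L <=
  factor U k * \sum_(L : {set 'I_n * 'I_r} | L \subset below U k) weight k L.
Proof.
pose V := [set x in U | x.1 == k :> nat].
have -> : below U k.+1 = below U k :|: V.
  by apply/setP=> x; rewrite !inE -andb_orr ltnS leq_eqVlt orbC.
rewrite sum_subsetU; last first.
  rewrite disjoints_subset; apply/subsetP=> x; rewrite !inE => /andP[-> h].
  by rewrite /= ltn_eqF.
rewrite mulr_sumr; apply: ler_sum => L1 /subsetP L1k.
have L1lt x : x \in L1 -> (x.1 < k)%N by move/L1k; rewrite inE => /andP[].
have bp := exprn_gt0 _ b0.
have rows (L2 : {set 'I_n * 'I_r}) : L2 \subset V ->
    (forall j, (j < k)%N -> rowsize (L1 :|: L2) j = rowsize L1 j) /\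
    rowsize (L1 :|: L2) k = #|L2|.
  move=> /subsetP L2V; split=> [j jk|]; apply: eq_card => x; rewrite !inE.
    case: (boolP (x \in L2)) => [/L2V|_]; rewrite ?orbF // inE.
    by case/andP=> _ /eqP->; rewrite gtn_eqF // !andbF.
  case: (boolP (x \in L2)) => [/L2V|_]; first by rewrite inE orbT => /andP[_ ->].
  by rewrite orbF; case: (boolP (x \in L1)) => // /L1lt/ltn_eqF->.
rewrite (eq_bigr (fun L2 : {set 'I_n * 'I_r} =>
  (y * b) ^+ #|L1| / b ^+ (r * rho r (rowsize L1) k) *
  ((y * b) ^+ #|L2| / b ^+ (r * increment k (reach r (rowsize L1) k) #|L2|)
   * potential (shift k (reach r (rowsize L1) k) #|L2|)))); last first.
  move=> L2 L2V; have [hlt hk] := rows L2 L2V; rewrite /weight /=.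
  rewrite (eq_rho _ hlt) (eq_reach _ hlt) /active hk.
  rewrite mulnDr exprD invfM -/(shift _ _ _).
  rewrite cardsU (_ : L1 :&: L2 = set0) ?cards0 ?subn0 ?exprD; last first.
    apply/setP=> x; rewrite !inE; apply/andP => -[/L1lt xk /(subsetP L2V)].
    by rewrite inE ltn_eqF ?andbF.
  by rewrite /increment; ring.
rewrite -mulr_sumr /weight mulrCA ler_wpM2l ?divr_ge0 ?exprn_ge0 ?mulr_ge0
  ?(ltW y0) ?(ltW b0) //.
apply: sum_row; last exact: reach_le.
exact: (rowsize_le U k).
Qed.

Lemma sum_weight_le U :
  \sum_(L : {set 'I_n * 'I_r} | L \subset U)
    (y * b) ^+ #|L| / b ^+ (r * rho r (rowsize L) n) <= \prod_(k < n) factor U k.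
Proof.
apply: (@le_trans _ _ (\sum_(L : {set 'I_n * 'I_r} | L \subset below U n) weight n L)).
  rewrite (_ : below U n = U); last by apply/setP=> x; rewrite inE ltn_ord andbT.
  apply: ler_sum => L _; rewrite ler_peMr ?potential_ge1 //.
  by rewrite divr_ge0 ?exprn_ge0 ?mulr_ge0 // ltW.
have : forall k, \sum_(L : {set 'I_n * 'I_r} | L \subset below U k) weight k L <=
    \prod_(j < k) factor U j.
  elim=> [|k IH].
    rewrite big_ord0 (_ : below U 0 = set0); last by apply/setP=> x; rewrite !inE andbF.
    rewrite (eq_bigl (pred1 set0)) => [|L]; last by rewrite subset0.
    by rewrite big_pred1_eq /weight cards0 /potential /= muln0 !expr0 mul0r addr0 divr1 mulr1.
  apply: (le_trans (sum_weight_step U k)).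
  rewrite big_ord_recr /= mulrC ler_wpM2r //.
  by apply: le_trans (factor_ge1 U k).
exact.
Qed.

Lemma prod_factor_le U : \prod_(k < n) factor U k <=
  ((2 * b) ^+ r) ^+ r * (1 + 2 * z * (b / b ^+ r)) ^+ n.
Proof.
set c := (2 * b) ^+ r; set d := 1 + _.
have c1 : 1 <= c by rewrite exprn_ege1 //; move: b1; lra.
have d1 : 1 <= d by rewrite lerDl (mulr_ge0 z20 theta0).
apply: (@le_trans _ _ (\prod_(k < n) ((if (k < r)%N then c else 1) * d))).
  apply: ler_prod => k _; rewrite (le_trans _ (factor_ge1 U k)) //= /factor.
  case: ifP => _; first by case: ifP => _; rewrite ?mul1r // -[leLHS]mul1r ler_pM.
  by case: ifP => _; rewrite ?mul1r // ler_peMr // (le_trans _ c1).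
rewrite big_split /= prodr_const card_ord ler_wpM2r ?exprn_ge0 ?(le_trans _ d1) //.
rewrite -big_mkcond prodr_const ler_weXn2l //.
rewrite -[leqRHS]card_ord.
rewrite -(card_in_imset (f := fun k : 'I_n => insubd (Ordinal r0) (k : nat))) ?max_card //.
move=> i j ir jr /(congr1 val).
have {}ir : (i < r)%N := ir; have {}jr : (j < r)%N := jr.
by rewrite /= !val_insubd ir jr => h; apply: val_inj.
Qed.

(** Away from the first [r] positions the crude factor never occurs, and at most [#|U|] rows are
    nonempty. *)
Lemma prod_factor_le_card U : (forall x, x \in U -> (r <= x.1)%N) ->
  \prod_(k < n) factor U k <= (1 + 2 * z * (b / b ^+ r)) ^+ #|U|.
Proof.
move=> hU; set d := 1 + _.
have d1 : 1 <= d by rewrite lerDl (mulr_ge0 z20 theta0).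
have -> : \prod_(k < n) factor U k = \prod_(k < n | k \in fst @: U) d.
  rewrite [RHS]big_mkcond; apply: eq_bigr => k _; rewrite /factor.
  case: imsetP => [[x xU kx]|no].
    have -> : rowsize U k == 0%N = false.
      apply/negbTE; rewrite -lt0n; apply/card_gt0P; exists x.
      by rewrite inE xU kx eqxx.
    by rewrite kx ltnNge hU.
  rewrite /rowsize (_ : [set x in U | _] = set0) ?cards0 //.
  apply/setP=> x; rewrite !inE; apply/negbTE/negP => /andP[xU /eqP xk].
  by apply: no; exists x => //; apply: val_inj.
by rewrite prodr_const ler_weXn2l // leq_imset_card.
Qed.

End Weights.

(** * Labels, members of the family and their spread *)

Lemma set2_eq (T : finType) (a b c d : T) : a != b ->
  [set a; b] = [set c; d] -> a = c /\ b = d \/ a = d /\ b = c.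
Proof.
move=> ab e.
have : a \in [set c; d] by rewrite -e set21.
have : b \in [set c; d] by rewrite -e set22.
rewrite !inE => /orP[]/eqP eb /orP[]/eqP ea; rewrite ea eb ?eqxx in ab *; by [left|right|].
Qed.

Section Labels.
(* The label (i, d) stands for the edge joining positions i and i - (d + 1) of
   the cyclic order. *)
Variables (r m : nat).
Notation n := m.+1.
Notation label := ('I_n * 'I_r)%type.
Hypotheses (rn : (2 * r < n)%N) (r0 : (0 < r)%N).

Definition step (d : 'I_r) : 'I_n := inZp d.+1.
Definition back (x : label) : 'I_n := x.1 - step x.2.

Lemma val_step d : val (step d) = d.+1.
Proof. by rewrite /= modn_small //; have := ltn_ord d; lia. Qed.

Lemma step_inj : injective step.
Proof.
by move=> d d' /(congr1 val); rewrite !val_step => -[h]; apply: val_inj.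
Qed.

Lemma step_neq0 d : step d != 0.
Proof. by rewrite -val_eqE val_step. Qed.

Lemma stepD_neq0 d d' : step d + step d' != 0.
Proof.
rewrite -val_eqE /= modnDm modn_small //.
by have := ltn_ord d; have := ltn_ord d'; lia.
Qed.

Lemma back_neq x : x.1 != back x.
Proof. by rewrite -subr_eq0 opprB addrC subrK step_neq0. Qed.

Lemma backE (x : label) (v : 'I_n) : (v + x.2.+1 = x.1)%N -> back x = v.
Proof.
move=> h; apply/eqP; rewrite subr_eq eq_sym -val_eqE /= modnDmr h.
by rewrite modn_small.
Qed.

Definition edge0 : edge 'I_n.
Proof.
exists [set ord0; ord_max]; rewrite cards2.
by rewrite -val_eqE /=; have := rn; have := r0; case: (m) => //; lia.
Defined.

(** For injective [s] the two ends differ, so the default [edge0] is never taken. *)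
Definition label_edge (s : 'I_n -> 'I_n) (x : label) : edge 'I_n :=
  insubd edge0 [set s x.1; s (back x)].

Lemma val_label_edge s x : injective s ->
  val (label_edge s x) = [set s x.1; s (back x)].
Proof.
by move=> si; rewrite val_insubd cards2 (inj_eq si) back_neq.
Qed.

(** Two labels of one edge with swapped ends would give [step x.2 + step y.2 = 0], impossible modulo
    [n] as [2 * r < n]. *)
Lemma label_edge_inj s : injective s -> injective (label_edge s).
Proof.
move=> si x y /(congr1 val); rewrite !val_label_edge //.
case/set2_eq => [|[]|[]]; first by rewrite (inj_eq si) back_neq.
  move=> /si e1 /si; rewrite /back e1 => /addrI/oppr_inj/step_inj e2.
  by rewrite [x]surjective_pairing e1 e2 -surjective_pairing.
move=> /si e1 /si e2; have := stepD_neq0 x.2 y.2.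
have stepE (u : label) : step u.2 = u.1 - back u by rewrite subKr.
by rewrite !stepE e2 {1}e1 addrA subrK subrr eqxx.
Qed.

Definition near (u v : 'I_n) : bool :=
  [exists d, (u - v == step d) || (v - u == step d)].

Lemma card_near v : (#|[set u | near u v]| <= 2 * r)%N.
Proof.
apply: (@leq_trans #|[set v + step d | d : 'I_r] :|: [set v - step d | d : 'I_r]|).
  apply/subset_leq_card/subsetP=> u; rewrite !inE => /existsP[d /orP[]/eqP h].
    by apply/orP; left; apply/imsetP; exists d; rewrite // -h subrKC.
  by apply/orP; right; apply/imsetP; exists d; rewrite // -h subKr.
rewrite cardsU (leq_trans (leq_subr _ _)) // mul2n -addnn.
by rewrite leq_add // (leq_trans (leq_imset_card _ _)) // card_ord.
Qed.

Variable q : nat.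
Hypothesis rnq : (r * n <= q)%N.

(** An arbitrary [f] lets the same coloured edges be described again after a rotation of the
    positions. *)
Definition placement (s : 'I_n -> 'I_n) (f : label -> 'I_q) (U : {set label}) :
  {set edge 'I_n * 'I_q} := [set (label_edge s x, f x) | x in U].

Lemma card_label : (#|{: label}| <= q)%N.
Proof. by rewrite card_prod !card_ord mulnC. Qed.

(** The bound [r * n <= q] leaves every label a colour of its own, which makes each member
    rainbow. *)
Definition label_colour (x : label) : 'I_q := widen_ord card_label (enum_rank x).

Lemma label_colour_inj : injective label_colour.
Proof. by move=> x y /(congr1 val)/= /val_inj/enum_rank_inj. Qed.

Notation family := ({perm 'I_n} * {perm 'I_q})%type.

Definition member (w : family) : {set edge 'I_n * 'I_q} :=
  placement w.1 (w.2 \o label_colour) setT.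

Lemma functional_placement (s : {perm 'I_n}) f U : functional (placement s f U).
Proof.
move=> _ _ /imsetP[x _ ->] /imsetP[y _ ->] /= /label_edge_inj ->//.
exact: perm_inj.
Qed.

Lemma memberP (w : family) e c :
  reflect (exists2 x, label_edge w.1 x = e & w.2 (label_colour x) = c)
  ((e, c) \in member w).
Proof.
apply: (iffP imsetP) => [[x _ [-> ->]]|[x <- <-]]; first by exists x.
by exists x.
Qed.

Section Cov.
Variable R : realType.
Notation e := (expR (1 : R)).
Variables (s0 : {perm 'I_n}) (f0 : label -> 'I_q).
Hypothesis f0i : injective f0.
Variable L : {set label}.

Let A := placement s0 f0 L.

Let Q : {set {perm 'I_n}} :=
  [set s | [exists t : {perm 'I_q}, A \subset member (s, t)]].

(** The map [s0] followed by [s^-1] sends the ends of each label of [L] to [near] positions, so the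
    forest from [rho_forest] constrains it. *)
Lemma card_Q : #|Q|%:R <=
  (e ^+ 2 * (2 * r)%:R / n%:R) ^+ rho r (rowsize L) n * n`!%:R :> R.
Proof.
pose g (s : {perm 'I_n}) : {perm 'I_n} := (s0 * s^-1)%g.
have gi : injective g by move=> s s' /mulgI/invg_inj.
rewrite -(card_imset _ gi).
have [B [fB sB lB _]] := @rho_forest r n L n (leqnn n).
have := @card_forest_perm R 'I_n (g @: Q) B near (2 * r) fB.
rewrite card_ord sB; apply=> //; last exact: card_near.
move=> _ /imsetP[s + ->]; rewrite inE => /existsP[t /subsetP At].
apply/allP=> -[o a] /(allP lB)/existsP[x /andP[xL]] /=.
have : (label_edge s0 x, f0 x) \in A by apply: imset_f.
move=> /At/memberP[y /= ey _].
have h : [set g s x.1; g s (back x)] = [set y.1; back y].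
  have := congr1 (fun E : edge 'I_n => (s^-1)%g @: val E) ey.
  rewrite !val_label_edge; try exact: perm_inj.
  by rewrite !imsetU1 !imset_set1 !permK /g !permM => ->.
have nr : near (g s x.1) (g s (back x)) && near (g s (back x)) (g s x.1).
  have gn : g s x.1 != g s (back x) by rewrite (inj_eq perm_inj) back_neq.
  have yb : y.1 - back y = step y.2 by rewrite subKr.
  by case: (set2_eq gn h) => -[-> ->]; apply/andP; split; apply/existsP;
    exists y.2; rewrite yb eqxx ?orbT.
case/andP: nr => n1 n2.
case/orP=> /andP[/eqP h1 /eqP /backE h2].
  by rewrite -h2 (val_inj h1).
by rewrite -h2 (val_inj h1).
Qed.

(** For fixed [s] an edge of [A] has a single label, and its colour then prescribes [t] at one
    point; as [f0] is injective, [#|L|] points are prescribed. *)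
Lemma card_colourings s :
  (#|[set t : {perm 'I_q} | A \subset member (s, t)]| <= (q - #|L|)`!)%N.
Proof.
set P := [set t | _].
have [->|[t0]] := set_0Vmem P; first by rewrite cards0.
rewrite inE => /subsetP At0.
pose V := [set c | t0 c \in f0 @: L].
have <- : #|V| = #|L|.
  rewrite -(card_imset _ f0i) -(card_imset V (@perm_inj _ t0)).
  apply: eq_card => c; apply/imsetP/idP => [[c']|cL]; first by rewrite inE => h ->.
  by exists ((t0^-1)%g c); rewrite ?inE permKV.
have := card_perm_agree V t0; rewrite card_ord; apply: leq_trans.
apply/subset_leq_card/subsetP=> t; rewrite !inE => /subsetP At.
apply/forall_inP=> c; rewrite inE => /imsetP[x xL e0].
have xA : (label_edge s0 x, f0 x) \in A by apply: imset_f.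
have /memberP[y /= ey fy] := At0 _ xA; have /memberP[z /= ez fz] := At _ xA.
have yz : y = z by apply: (label_edge_inj (@perm_inj _ s)); rewrite ey ez.
have -> : c = label_colour y by apply: (@perm_inj _ t0); rewrite e0 fy.
by rewrite fy yz fz.
Qed.

Lemma cov_placement : cov R member A <=
  (e ^+ 2 * (2 * r)%:R / n%:R) ^+ rho r (rowsize L) n * (e / q%:R) ^+ #|L|.
Proof.
have Lq : (#|L| <= q)%N by apply: leq_trans (max_card _) card_label.
have q0 : 0 < q%:R :> R.
  by rewrite ltr0n; apply: leq_trans rnq; rewrite muln_gt0 r0.
have F0 k : 0 < k`!%:R :> R by rewrite ltr0n fact_gt0.
rewrite /cov card_prod !card_Sn natrM.
rewrite ler_pdivrMr ?mulr_gt0 //.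
apply: (@le_trans _ _ (#|Q|%:R * (q - #|L|)`!%:R)).
  rewrite -natrM ler_nat -sum1_card (partition_big fst (mem Q)) /=; last first.
    by move=> [s t]; rewrite !inE /= => h; apply/existsP; exists t.
  rewrite -sum_nat_const; apply: leq_sum => s _; rewrite sum1dep_card.
  apply: leq_trans (card_colourings s).
  rewrite -(card_in_imset (f := snd)).
    apply/subset_leq_card/subsetP=> _ /imsetP[[s1 t1] + ->].
    by rewrite !inE /= => /andP[h /eqP <-].
  by move=> [s1 t1] [s2 t2]; rewrite !inE /= => /andP[_ /eqP->] /andP[_ /eqP->] ->.
have h1 := card_Q; have h2 := fact_sub_le R Lq.
rewrite mulrACA; apply: ler_pM => //.
by rewrite expr_div_n mulrAC ler_pdivlMr ?exprn_gt0.
Qed.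

End Cov.
End Labels.

(** * Transfer to the coloured random graph *)

Section Conversion.
Variables (R : realType) (n q : nat).
Hypothesis q0 : (0 < q)%N.

Definition extend (G : graph 'I_n) (col : coloring q G) :
  {ffun edge 'I_n -> option 'I_q} :=
  [ffun e => if insub e is Some x then Some (col x) else None].

Lemma extendE (G : graph 'I_n) (col : coloring q G) (x : {e | e \in G}) :
  extend col (val x) = Some (col x).
Proof. by rewrite ffunE valK. Qed.

Lemma extend_mass (p : R) (G : graph 'I_n) (col : coloring q G) :
  \prod_e cmass p (extend col e) = gnp_mass p G * coloring_mass R col.
Proof.
have -> : coloring_mass R col = \prod_(e : edge 'I_n) (if e \in G then q%:R^-1 else 1).
  rewrite /coloring_mass prodr_const -big_mkcond prodr_const card_sig.
  by congr (_ ^+ _); apply: eq_card.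
rewrite /gnp_mass -big_split; apply: eq_bigr => e _ /=.
rewrite ffunE; case: insubP => [x eG _|/negbTE ->] /=; last by rewrite mulr1.
by rewrite eG card_ord.
Qed.

(** A partial colouring amounts to its set of present edges with their colours, and the masses agree
    by [extend_mass]. *)
Lemma expect_le_colored_gnp (p : R) (Q : {ffun edge 'I_n -> option 'I_q} -> bool)
    (A : forall G : graph 'I_n, coloring q G -> bool) : 0 <= p -> p <= 1 ->
  (forall G col, Q (@extend G col) -> A G col) ->
  expect (cmass p) (fun W => (Q W)%:R) <= colored_gnp_prob p A.
Proof.
move=> p0 p1 QA.
rewrite /expect (partition_big (fun W : {ffun edge 'I_n -> option 'I_q} =>
  [set e | W e != None]) xpredT) //=.
apply: ler_sum => G _.
(* For [W] with set of present edges [G], the default [Ordinal q0] never occurs. *)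
pose restr (W : {ffun edge 'I_n -> option 'I_q}) : coloring q G :=
  [ffun x => odflt (Ordinal q0) (W (val x))].
rewrite (reindex_onto (@extend G) restr) /=; last first.
  move=> W /eqP WG; apply/ffunP=> e; rewrite ffunE; case: insubP => [x eG ex|].
    by rewrite ffunE ex; move: eG; rewrite -WG inE; case: (W e).
  by rewrite -WG inE negbK => /eqP.
rewrite big_mkcond [leRHS]big_mkcond /=; apply: ler_sum => col _.
have m0 : 0 <= gnp_mass p G * coloring_mass R col.
  rewrite -extend_mass; apply: prodr_ge0 => e _; exact: cmass_ge0.
case: ifP => _; last by case: ifP.
rewrite extend_mass; case: ifP => [_|/negbT nA].
  by rewrite -[leRHS]mulr1 ler_wpM2l // lern1 leq_b1.
by rewrite (_ : Q _ = false) ?mulr0 //; apply: contraNF nA; exact: QA.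
Qed.

End Conversion.

(** * Members contain rainbow powers of Hamilton cycles *)

Section HamiltonPower.
Variables (r m q : nat).
Notation n := m.+1.
Notation label := ('I_n * 'I_r)%type.
Hypotheses (rn : (2 * r < n)%N) (r2 : (2 <= r)%N) (rnq : (r * n <= q)%N).
Let r0 : (0 < r)%N := ltnW r2.

Lemma next_codom (s : {perm 'I_n}) (i : 'I_n) :
  next (codom s) (s i) = s (i + inZp 1).
Proof.
rewrite codomE (next_map (@perm_inj _ s)) ?enum_uniq //; congr (s _).
rewrite next_nth mem_enum inE /= index_enum_ord.
apply: val_inj; case E: (enum 'I_n) => [|y p].
  by have := size_enum_ord n; rewrite E.
have ey : y = ord0 by have := nth_enum_ord ord0 (ltn0Sn m); rewrite E /= => h; apply: val_inj.
have sp : size p = m by have := size_enum_ord n; rewrite E /= => -[].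
rewrite /= modnDmr addn1.
have [im|im] := ltnP i.+1 n.
  rewrite modn_small //; have := nth_enum_ord y im; by rewrite E.
rewrite nth_default ?ey /=; last by rewrite sp -ltnS.
by rewrite (_ : i.+1 = n) ?modnn //; apply/eqP; rewrite eqn_leq im ltn_ord.
Qed.

Definition cycle_of (s : {perm 'I_n}) : graph 'I_n :=
  [set e | [exists x, val e == [set x; next (codom s) x]]].

Lemma cycle_of_hamilton s : hamilton_cycle (cycle_of s).
Proof.
apply/existsP; exists (codom_tuple s); apply/and3P; split=> //.
  by rewrite card_ord; move: rn r2; lia.
by rewrite map_inj_uniq ?enum_uniq //; exact: perm_inj.
Qed.

Lemma inZpD j k : inZp (j + k) = inZp j + inZp k :> 'I_n.
Proof. by apply: val_inj; rewrite /= modnDm. Qed.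

Lemma adj_cycle_of s (i j : 'I_n) : adj (cycle_of s) (s i) (s j) ->
  j = i + inZp 1 \/ i = j + inZp 1.
Proof.
case/exists_inP=> e; rewrite inE => /existsP[x /eqP ex] /eqP e2.
have sij : s i != s j.
  by have := valP e; rewrite e2 cards2; case: (s i != s j).
have := set2_eq sij (etrans (esym e2) ex).
rewrite -[x](permKV s) next_codom.
by case=> -[/perm_inj -> /perm_inj ->]; [left|right].
Qed.

(** A walk may turn back; opposite steps cancel, so its net displacement [k], in one direction or
    the other, is at most its length. *)
Lemma path_cycle_of s (i : 'I_n) (t : seq 'I_n) : path (adj (cycle_of s)) (s i) t ->
  exists2 k, (k <= size t)%N & exists2 j, last (s i) t = s j &
    j = i + inZp k \/ i = j + inZp k.
Proof.
have z0 : inZp 0 = 0 :> 'I_n by apply: val_inj; rewrite /= mod0n.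
have zS k' : inZp k'.+1 = inZp 1 + inZp k' :> 'I_n by rewrite -inZpD.
elim: t i => [|x t IH] i /=.
  by exists 0%N => //; exists i => //; left; rewrite z0 addr0.
rewrite -[x](permKV s) => /andP[/adj_cycle_of h /IH[k kt [j -> hj]]].
case: h hj => [->|->] [hj|hj].
- by exists k.+1 => //; exists j => //; left; rewrite hj (zS k) addrA.
(* The first step goes against the rest and cancels one unit; for [k = 0] it is the whole
   displacement. *)
- case: k kt hj => [|k] kt hj.
    by exists 1%N => //; exists j => //; left; rewrite hj z0 addr0.
  exists k; first by lia.
  exists j => //; right; move: hj.
  by rewrite (zS k) (addrC (inZp 1) (inZp k)) addrA => /addIr.
- case: k kt hj => [|k] kt hj.
    by exists 1%N => //; exists j => //; right; rewrite hj z0 addr0.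
  exists k; first by lia.
  by exists j => //; left; rewrite hj (zS k) addrA.
by exists k.+1 => //; exists j => //; right; rewrite hj (zS k) (addrC (inZp 1)) addrA.
Qed.

Lemma power_edge_label s e : e \in graph_power r (cycle_of s) ->
  exists x : label, label_edge rn r0 s x = e.
Proof.
have mk (i j : 'I_n) k : val e = [set s i; s j] -> (0 < k)%N -> (k <= r)%N ->
    i = j + inZp k -> exists x : label, label_edge rn r0 s x = e.
  case: k => // k ee _ kr ij; exists (i, Ordinal kr); apply: val_inj.
  rewrite val_label_edge ?ee; last exact: perm_inj.
  by rewrite /= /back /= ij /step /= addrK.
have mk2 (i j : 'I_n) k : val e = [set s i; s j] -> (0 < k)%N -> (k <= r)%N ->
    (j = i + inZp k \/ i = j + inZp k) -> exists x : label, label_edge rn r0 s x = e.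
  move=> ee k0 kr [h|h]; last exact: (mk i j k).
  by apply: (mk j i k) => //; rewrite ee setUC.
rewrite !inE => /orP[/existsP[x /eqP]|].
  rewrite -[x](permKV s) next_codom => ee.
  by apply: (mk2 _ _ 1%N ee) => //; left.
case/existsP=> x /existsP[y] /andP[/eqP ee /existsP[t /and3P[]]].
move: ee; rewrite -[x](permKV s) -[y](permKV s) => ee /path_cycle_of[k kt [j -> hj]] _.
rewrite (inj_eq perm_inj) => /eqP ej; rewrite ej in hj.
apply: (mk2 _ _ k ee) => //; last first.
  by apply: leq_trans kt _; have := size_bseq t.
(* Displacement 0 would make the two ends of [e] equal. *)
rewrite lt0n; apply/eqP=> k0; move: hj; rewrite k0.
have -> : inZp 0 = 0 :> 'I_n by apply: val_inj; rewrite /= mod0n.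
rewrite !addr0 => hj; have := valP e; rewrite ee cards2.
by case: hj => ->; rewrite eqxx.
Qed.

(** Distinct edges of the power have distinct labels, whose colours differ because [label_colour]
    and [w.2] are injective. *)
Lemma member_rainbow (G : graph 'I_n) (col : coloring q G) w :
  member rn r0 rnq w \subset gr (extend col) -> has_rainbow_hamilton_power r col.
Proof.
move=> /subsetP wG.
have lab e : e \in graph_power r (cycle_of w.1) ->
    exists2 x : label, label_edge rn r0 w.1 x = e &
      extend col e = Some (w.2 (label_colour rnq x)).
  case/power_edge_label=> x ex; exists x => //; apply/eqP.
  have /wG : (e, w.2 (label_colour rnq x)) \in member rn r0 rnq w.
    by apply/memberP; exists x.
  by rewrite inE.
apply/existsP; exists (graph_power r (cycle_of w.1)); apply/and3P; split.
- apply/subsetP=> e /lab[x _]; rewrite ffunE; case: insubP => //.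
- by apply/existsP; exists (cycle_of w.1); rewrite cycle_of_hamilton eqxx.
apply/dinjectiveP=> e1 e2 /lab[x1 ex1 +] /lab[x2 ex2 +] ecol.
rewrite !extendE => -[h1] [h2]; apply: val_inj.
rewrite -ex1 -ex2; suff -> : x1 = x2 by [].
by apply: (@label_colour_inj _ _ _ rnq); apply: (@perm_inj _ w.2); rewrite -h1 -h2.
Qed.

End HamiltonPower.

(** * Bounds for the sums over subsets of one member *)

Lemma sum_subset_imset (R : nmodType) (S T : finType) (g : S -> T)
    (U : {set S}) (F : {set T} -> R) : injective g ->
  \sum_(A : {set T} | A \subset g @: U) F A =
  \sum_(L : {set S} | L \subset U) F (g @: L).
Proof.
move=> gi; have preK (L : {set S}) : g @^-1: (g @: L) = L.
  by apply/setP=> x; rewrite inE mem_imset.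
rewrite (reindex_onto (fun L : {set S} => g @: L) (fun A => g @^-1: A)) /=.
  apply: eq_bigl => L; rewrite preK eqxx andbT.
  apply/subsetP/subsetP => h x xL; last by case/imsetP: xL => y /h yU ->; apply: imset_f.
  by have := h (g x); rewrite !mem_imset // => ->.
move=> A /subsetP AU; apply/setP=> y; apply/imsetP/idP => [[x + ->]|yA].
  by rewrite inE.
by have /imsetP[x _ e] := AU y yA; exists x; rewrite // inE -e.
Qed.

Lemma pow_le_expR (R : realType) (c : R) (k : nat) :
  0 <= c -> (1 + c) ^+ k <= expR (c * k%:R).
Proof.
move=> c0; apply: (@le_trans _ _ (expR c ^+ k)).
  by rewrite lerXn2r ?nnegrE ?expR_ge0 ?addr_ge0 // expR_ge1Dx.
by rewrite mulrC expRM_natl.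
Qed.

Lemma pow_le_fact_expR (R : realType) (c : R) (k : nat) :
  0 <= c -> c ^+ k <= k`!%:R * expR c.
Proof.
move=> c0; case: k => [|k].
  by rewrite expr0 mul1r; apply: le_trans (expR_ge1Dx _); rewrite lerDl.
rewrite mulrC -ler_pdivrMr ?ltr0n ?fact_gt0 //.
by apply: le_trans (expR_ge1Dxn k c0); rewrite lerDr.
Qed.

Section Sums.
Variables (R : realType) (r m q : nat).
Notation n := m.+1.
Notation label := ('I_n * 'I_r)%type.
Notation e := (expR (1 : R)).
Hypotheses (rn : (2 * r < n)%N) (r2 : (2 <= r)%N) (rnq : (r * n <= q)%N).
Let r0 : (0 < r)%N := ltnW r2.
Variables (b kappa delta y : R).
Hypotheses (b1 : 1 <= b) (bn : b ^+ r = n%:R) (k0 : 0 < kappa).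
Hypotheses (d0 : 0 < delta) (d1 : delta <= 1) (y0 : 0 < y).
Hypothesis yr : 2 * r%:R * (2 ^+ r * y) <= 1.
Hypothesis ykd : e * (e ^+ 2 * (2 * r)%:R) <= delta * y * kappa.

Notation S := (member rn r0 rnq).
Notation x := (#|'I_q|%:R / (kappa / b)).

Let b0 : 0 < b. Proof. exact: lt_le_trans b1. Qed.
Let q0 : 0 < q%:R :> R.
Proof. by rewrite ltr0n; apply: leq_trans rnq; rewrite muln_gt0 r0. Qed.
Let e1 : 1 <= e. Proof. by apply: le_trans (expR_ge1Dx _); rewrite lerDl. Qed.

(** By [cov_placement] each label costs [e * b / kappa] and each forest edge a further
    [e ^+ 2 * (2 * r) / b ^+ r], since [n] is [b ^+ r]. As [rho] is at most [#|L|], [ykd] absorbs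
    all constants into [delta * y] per label. *)
Lemma term_le (s0 : {perm 'I_n}) (f0 : label -> 'I_q) (L : {set label}) :
  injective f0 ->
  x ^+ #|L| * cov R S (placement rn r0 s0 f0 L) <=
  delta ^+ #|L| * ((y * b) ^+ #|L| / b ^+ (r * rho r (rowsize L) n)).
Proof.
move=> f0i; set p := rho _ _ _; set a := #|L|.
have pa : (p <= a)%N by apply: rho_le.
have x0 : 0 < x by rewrite card_ord !divr_gt0.
have bp : 0 < b ^+ (r * p) by rewrite exprn_gt0.
apply: le_trans (ler_wpM2l (exprn_ge0 _ (ltW x0)) (cov_placement rn r0 rnq R s0 f0i L)) _.
rewrite -/p -/a card_ord mulrA ler_pdivlMr //.
set c := e ^+ 2 * (2 * r)%:R.
have c1 : 1 <= c.
  rewrite -[leLHS]mul1r ler_pM // ?exprn_ege1 // ler1n muln_gt0 //.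
have c0 : 0 < c by apply: lt_le_trans c1.
have -> : (q%:R / (kappa / b)) ^+ a * ((c / n%:R) ^+ p * (e / q%:R) ^+ a) * b ^+ (r * p)
   = (e * b / kappa) ^+ a * c ^+ p.
  have -> : (c / n%:R) ^+ p = c ^+ p / b ^+ (r * p) by rewrite -bn expr_div_n exprM.
  have -> : e * b / kappa = (q%:R / (kappa / b)) * (e / q%:R).
    by field; rewrite !gt_eqF.
  rewrite [(_ * (e / _)) ^+ a]exprMn.
  move: ((q%:R / (kappa / b)) ^+ a) ((e / q%:R) ^+ a) (c ^+ p) (b ^+ _) bp => X Y D B B0.
  by field; rewrite gt_eqF.
apply: (@le_trans _ _ ((e * b / kappa) ^+ a * c ^+ a)).
  rewrite ler_wpM2l ?ler_weXn2l // exprn_ge0 // divr_ge0 ?mulr_ge0 ?(ltW b0) ?(ltW k0) //.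
  exact: le_trans e1.
rewrite -!exprMn; apply: lerXn2r; rewrite ?nnegrE.
- by rewrite !mulr_ge0 ?invr_ge0 ?expR_ge0 ?(ltW b0) ?(ltW k0) ?(ltW c0).
- by rewrite !mulr_ge0 // ltW.
rewrite mulrAC ler_pdivrMr //.
have := ler_wpM2r (ltW b0) ykd; rewrite -/c; lra.
Qed.

(** The factor [delta] per label is set aside and yields [delta ^+ t]; the remaining weights are
    summed by [sum_weight_le]. *)
Lemma sum_placement_le (s0 : {perm 'I_n}) (f0 : label -> 'I_q) (U : {set label})
    (t : nat) (P : pred {set edge 'I_n * 'I_q}) : injective f0 ->
  (forall A : {set edge 'I_n * 'I_q}, P A -> (t <= #|A|)%N) ->
  \sum_(A : {set edge 'I_n * 'I_q} | (A \subset placement rn r0 s0 f0 U) && P A)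
    x ^+ #|A| * cov R S A <= delta ^+ t * \prod_(k < n) factor y b U k.
Proof.
move=> f0i hP.
have gi : injective (fun z : label => (label_edge rn r0 s0 z, f0 z)) by move=> u v [_ /f0i].
rewrite big_mkcondr (sum_subset_imset _ _ gi) /=.
apply: le_trans (ler_wpM2l (exprn_ge0 t (ltW d0)) (sum_weight_le r0 y0 b1 yr U)).
rewrite mulr_sumr; apply: ler_sum => L LU.
have w0 : 0 <= (y * b) ^+ #|L| / b ^+ (r * rho r (rowsize L) n).
  by rewrite divr_ge0 ?exprn_ge0 ?mulr_ge0 // ltW.
case: ifP => [/hP|_]; last by rewrite mulr_ge0 // exprn_ge0 // ltW.
rewrite card_imset // => tL; apply: le_trans (term_le _ _ f0i) _.
by rewrite ler_wpM2r // ler_wiXn2l // ltW.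
Qed.

(* Rotating the cyclic order moves a small set of edges off the r positions
   whose edges wrap around. *)
Lemma rotate_small (w : {perm 'I_n} * {perm 'I_q}) (T : {set edge 'I_n * 'I_q}) :
  T \subset S w -> (r * #|T| < n)%N ->
  exists (s0 : {perm 'I_n}) (f0 : label -> 'I_q) (U : {set label}),
    [/\ injective f0, T = placement rn r0 s0 f0 U, #|U| = #|T| &
        forall z, z \in U -> (r <= z.1)%N].
Proof.
move=> TS rT.
pose f z := w.2 (label_colour rnq z).
have fi : injective f by move=> u v /perm_inj/label_colour_inj.
pose g z := (label_edge rn r0 w.1 z, f z).
have gi : injective g by move=> u v [_ /fi].
pose V := [set z | g z \in T].
have TV : T = g @: V.
  apply/setP=> u; apply/idP/imsetP => [uT|[z + ->]]; last by rewrite inE.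
  have /imsetP[z _ uz] := subsetP TS u uT; exists z; rewrite // inE.
  by rewrite uz in uT.
have cV : #|V| = #|T| by rewrite TV card_imset.
(* The rotations putting some label of [V] on one of the first [r] positions: at most [r] per label,
   hence fewer than [n]. *)
pose bad : {set 'I_n} := [set u.1.1 - inZp (u.2 : 'I_r) | u in setX V setT].
have [j jb] : exists j, j \notin bad.
  have bn' : (#|bad| < n)%N.
    apply: leq_ltn_trans (leq_imset_card _ _) _.
    by rewrite cardsX cardsT card_ord cV mulnC.
  case: (pickP [pred j | j \notin bad]) => [j jb|none]; first by exists j.
  move: bn'; rewrite (_ : bad = setT) ?cardsT ?card_ord ?ltnn //.
  by apply/setP=> j; rewrite [RHS]inE; have /negbFE := none j.
pose rot (z : label) : label := (z.1 + j, z.2).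
have ji : injective (fun u : 'I_n => u + j) by move=> u v /addIr.
have roti : injective rot.
  by move=> [u d] [v d'] h; have /ji /= -> := congr1 fst h; have := congr1 snd h => /= ->.
pose s1 := (perm ji * w.1)%g.
have gE z : (label_edge rn r0 s1 z, f (rot z)) = g (rot z).
  congr pair; apply: val_inj; rewrite !val_label_edge; try exact: perm_inj.
  by rewrite !permM !permE /= /back /= addrAC.
have UV : rot @: (rot @^-1: V) = V.
  apply/setP=> z; apply/imsetP/idP => [[u + ->]|zV]; first by rewrite inE.
  have ez : rot (z.1 - j, z.2) = z by rewrite /rot /= subrK -surjective_pairing.
  by exists (z.1 - j, z.2); rewrite ?ez //; move: zV; rewrite !inE ez.
exists s1, (f \o rot), (rot @^-1: V); split.
- exact: inj_comp fi roti.
- rewrite /placement (eq_imset (g := g \o rot) _ gE) imset_comp UV; exact: TV.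
- by rewrite -(card_imset _ roti) UV.
move=> z; rewrite inE => zV; rewrite leqNgt; apply/negP => zr.
case/negP: jb; apply/imsetP; exists (rot z, Ordinal zr) => /=.
  by rewrite in_setX zV in_setT.
have -> : inZp z.1 = z.1 by apply: val_inj; rewrite /= modn_small.
by rewrite addrC addKr.
Qed.

Let theta : R := b / b ^+ r.
Let z2 : R := 2 * (2 ^+ r * y).

Let theta0 : 0 <= theta.
Proof. by rewrite divr_ge0 ?exprn_ge0 // ltW. Qed.

Let z20 : 0 <= z2.
Proof. by rewrite !mulr_ge0 ?exprn_ge0 // ltW. Qed.

Let z21 : z2 <= 1.
Proof.
apply: le_trans yr; rewrite /z2 -mulrA ler_wpM2l // ler_peMl ?ler1n //.
by rewrite mulr_ge0 ?exprn_ge0 // ltW.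
Qed.

(** The first positions give [(2 * b) ^+ (r * r)] and the new chains at most [expR b], together at
    most a constant times [expR (3 * b)]. As [b <= t.+1], this is outweighed by [delta ^+ t.+1]. *)
Lemma large_sum_le (t : nat) w : b <= t.+1%:R -> delta * e ^+ 3 <= 1 ->
  \sum_(A : {set edge 'I_n * 'I_q} | (A \subset S w) && (t < #|A|)%N)
    x ^+ #|A| * cov R S A <= (r * r)`!%:R * (delta * e ^+ 3).
Proof.
move=> bt de1; have inj : injective (w.2 \o label_colour rnq).
  by move=> u v /perm_inj/label_colour_inj.
apply: le_trans (sum_placement_le _ _ inj (fun A h => h : (t.+1 <= #|A|)%N)) _.
apply: (@le_trans _ _ (delta ^+ t.+1 * ((r * r)`!%:R * (e ^+ 3) ^+ t.+1))); last first.
  rewrite mulrCA -exprMn ler_wpM2l // -[leRHS]expr1 ler_wiXn2l //.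
  by rewrite mulr_ge0 ?exprn_ge0 ?expR_ge0 // ltW.
rewrite ler_wpM2l ?exprn_ge0 ?(ltW d0) //.
apply: (le_trans (prod_factor_le r0 y0 b1 _)); rewrite -/theta -/z2 -exprM.
apply: (@le_trans _ _ ((r * r)`!%:R * expR (2 * b) * expR b)).
  have c0 : 0 <= z2 * theta by exact: mulr_ge0 z20 theta0.
  have b20 : 0 <= 2 * b by rewrite mulr_ge0 // ltW.
  apply: ler_pM.
  - exact: exprn_ge0.
  - by apply: exprn_ge0; exact: addr_ge0.
  - exact: pow_le_fact_expR.
  apply: le_trans (pow_le_expR _ c0) _.
  rewrite ler_expR -bn -mulrA /theta divfK ?expf_neq0 ?gt_eqF //.
  by rewrite ler_piMl // ltW.
rewrite -mulrA ler_wpM2l // -expRD -exprM.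
rewrite -[leRHS]expRM_natl mulr1 ler_expR natrM.
by move: bt; lra.
Qed.

(** After rotation at most [t] rows contribute, each with excess at most [b / b ^+ r]. The product
    stays below [e] because [t <= b] and [r >= 2] give [t * b <= b ^+ r]. *)
Lemma small_sum_le (t : nat) w (T : {set edge 'I_n * 'I_q}) :
  t%:R <= b -> (r * t < n)%N -> T \subset S w -> (#|T| <= t)%N ->
  \sum_(A : {set edge 'I_n * 'I_q} | (A \subset T) && (A != set0))
    x ^+ #|A| * cov R S A <= delta * e.
Proof.
move=> tb rt TS Tt.
have rT : (r * #|T| < n)%N by apply: leq_ltn_trans rt; rewrite leq_mul2l Tt orbT.
have [s0 [f0 [U [f0i eT UT hU]]]] := rotate_small TS rT; rewrite eT.
have h (A : {set edge 'I_n * 'I_q}) : A != set0 -> (1 <= #|A|)%N by rewrite card_gt0.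
apply: le_trans (sum_placement_le _ _ f0i h) _.
rewrite expr1 ler_wpM2l ?(ltW d0) //.
apply: (le_trans (prod_factor_le_card y0 b1 hU)); rewrite -/theta -/z2 UT.
apply: le_trans (pow_le_expR _ (mulr_ge0 z20 theta0)) _.
rewrite ler_expR -mulrA -[leRHS]mul1r; apply: ler_pM => //; first exact: mulr_ge0.
apply: (@le_trans _ _ (theta * b)).
  by rewrite ler_wpM2l // (le_trans _ tb) // ler_nat.
by rewrite /theta mulrAC ler_pdivrMr ?exprn_gt0 // mul1r -expr2 ler_weXn2l.
Qed.

End Sums.

(** * Choice of the constants and of the fragment size *)

Theorem theorem7 (R : realType) (eps : R) (heps : 0 < eps) (r : nat)
    (hr : (2 <= r)%N) :
  exists2 K : R, 0 < K &
    forall n : nat, (0 < n)%N ->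
    let p : R := K * (n%:R `^ (- (r%:R)^-1)) in
    p <= 1 ->
    forall q : nat, (r * n <= q)%N ->
      1 - eps <= colored_gnp_prob p
        (fun (G : graph 'I_n) (col : coloring q G) =>
           has_rainbow_hamilton_power r col).
Proof.
pose e : R := expR 1; pose M : R := (r * r)`!%:R.
(* The final error [2 * (M * (delta * e ^+ 3)) + 4 * (delta * e)] is at most
   [6 * (M * (delta * e ^+ 3))], which this choice keeps below [eps]; the summand 1 ensures
   [delta * e ^+ 3 <= 1]. *)
pose delta : R := (e ^+ 3 * (1 + 6 * M / eps))^-1.
(* [y] and [kappa] turn [yr] and [ykd] into equalities. *)
pose y : R := (2 * r%:R * 2 ^+ r)^-1.
pose kappa : R := e * (e ^+ 2 * (2 * r)%:R) / (delta * y).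
have e1 : 1 <= e by apply: le_trans (expR_ge1Dx _); rewrite lerDl.
have e0 : 0 < e by apply: lt_le_trans e1.
have M1 : 1 <= M by rewrite ler1n fact_gt0.
have rpos : 0 < r%:R :> R by rewrite ltr0n; lia.
have r2 : 2 <= r%:R :> R by rewrite ler_nat.
have de : delta * e ^+ 3 * (1 + 6 * M / eps) = 1.
  by rewrite -mulrA mulVf // gt_eqF // mulr_gt0 ?exprn_gt0 // addr_gt0 //
       divr_gt0 // mulr_gt0 //; lra.
have c1 : 0 < 6 * M / eps by rewrite divr_gt0 // mulr_gt0 //; lra.
have d0 : 0 < delta by rewrite invr_gt0 mulr_gt0 ?exprn_gt0 // addr_gt0.
have de0 : 0 < delta * e ^+ 3 by rewrite mulr_gt0 // exprn_gt0.
have de1 : delta * e ^+ 3 <= 1 by nra.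
have e31 : 1 <= e ^+ 3 by rewrite exprn_ege1.
have d1 : delta <= 1 by nra.
have y0 : 0 < y by rewrite invr_gt0 !mulr_gt0 ?exprn_gt0.
have y1 : y <= 1.
  rewrite invf_le1 ?mulr_gt0 ?exprn_gt0 //.
  have : 1 <= 2 ^+ r :> R by rewrite exprn_ege1 // ler1n.
  by nra.
have dy1 : delta * y <= 1 by nra.
have dy0 : 0 < delta * y by rewrite mulr_gt0.
have k2r : 2 * r%:R <= kappa.
  rewrite /kappa ler_pdivlMr // natrM.
  apply: (@le_trans _ _ (2 * r%:R)); first by nra.
  rewrite mulrA -exprS ler_peMl //; nra.
have k0 : 0 < kappa by nra.
(* The factor 2 pays for two rounds of density [kappa / b], where [b] is the [r]-th root of [n]. *)
exists (2 * kappa); first by rewrite mulr_gt0.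
case=> // m _ p p1 q rnq; set n := m.+1 in p p1 rnq *.
have n0 : 0 < n%:R :> R by rewrite ltr0n.
pose b : R := n%:R `^ (r%:R)^-1.
have b0 : 0 < b by rewrite powR_gt0.
have pE : p = 2 * (kappa / b) by rewrite /p powRN mulrA.
have bn : b ^+ r = n%:R.
  by rewrite -powR_mulrn ?ltW // -powRrM mulVf ?gt_eqF // powRr1 // ltW.
(* The assumption [p <= 1] forces [b >= 2 * kappa >= 4 * r], so [n >= b * b] is large enough and no
   small case remains. *)
have kb : 2 * kappa <= b by move: p1; rewrite pE mulrA ler_pdivrMr // mul1r.
have b1 : 1 <= b by nra.
have bbn : b * b <= n%:R by rewrite -bn -expr2 ler_weXn2l.
have rn : (2 * r < n)%N by rewrite -(ltr_nat R) natrM; nra.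
(* The integer part of [b] serves both sums: large ones use [b <= t.+1], small ones [t <= b]. *)
pose t := Num.truncn b.
have [tb bt] : t%:R <= b /\ b <= t.+1%:R.
  by have /andP[h1 h2] := truncn_itv (ltW b0); split=> //; exact: ltW.
have rt : (r * t < n)%N by rewrite -(ltr_nat R) natrM; nra.
pose r0 : (0 < r)%N := ltnW hr.
have q0 : (0 < q)%N by apply: leq_trans rnq; rewrite muln_gt0 r0.
have yr : 2 * r%:R * (2 ^+ r * y) <= 1.
  by rewrite /y mulrA divff // gt_eqF // !mulr_gt0 // exprn_gt0.
have ykd : e * (e ^+ 2 * (2 * r)%:R) <= delta * y * kappa.
  by rewrite /kappa [leRHS]mulrC divfK // gt_eqF.
have kb0 : 0 < kappa / b by rewrite divr_gt0.
have kb1 : 2 * (kappa / b) <= 1 by rewrite -pE.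
have kb2 : kappa / b <= 1 by lra.
have funS w : functional (member rn r0 rnq w) by exact: functional_placement.
have C0 : (0 < #|'I_q|)%N by rewrite card_ord.
have Om0 : (0 < #|{: {perm 'I_n} * {perm 'I_q}}|)%N.
  by apply/card_gt0P; exists (1%g, 1%g).
have := @two_rounds R _ _ _ (member rn r0 rnq) funS C0 Om0 _ kb0 kb2 t
  (M * (delta * e ^+ 3)) (delta * e) (mulr_ge0 (ler0n _ _) (ltW de0))
  (ltW (mulr_gt0 d0 e0))
  (fun w => large_sum_le rn hr rnq b1 bn k0 d0 d1 y0 yr ykd w bt de1)
  (fun w T => small_sum_le b1 bn k0 d0 d1 y0 yr ykd tb rt) kb1.
rewrite -pE => h.
apply: (@le_trans _ _ (1 - 2 * (M * (delta * e ^+ 3)) - 4 * (delta * e))).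
  have h1 : delta * e <= M * (delta * e ^+ 3).
    apply: (@le_trans _ _ (delta * e ^+ 3)).
      by rewrite ler_wpM2l ?(ltW d0) // -[leLHS]expr1 ler_weXn2l.
    by rewrite ler_peMl // ltW.
  have h2 : 6 * (M * (delta * e ^+ 3)) <= eps.
    have : delta * e ^+ 3 * (6 * M / eps) <= 1 by move: de; lra.
    by rewrite mulrA ler_pdivrMr // mul1r; lra.
  lra.
apply: (le_trans h); apply: expect_le_colored_gnp => //.
  by rewrite pE mulr_ge0 // ltW.
by move=> G col /existsP[w]; exact: member_rainbow.
Qed.
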